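(* Let $F$ be a field, $K$ a knot, $D$ a (pointed) diagram of $K$, and $z$ a cycle in the reduced complex that represents a generator of $\widetilde{\mathit{Kh}}_h(D;F)/\mathrm{Tor}\cong F[h]$. Then the two cycles $z,\ \widehat\nu(z)$ of the unreduced complex give a basis over $F[h]$ of \[ \mathit{Kh}_h(D;F)/\mathrm{Tor}\cong F[h]^2 . \] In particular, $s^F(K)=\tilde s^F(K)$.
   Context: Let $F$ be a field of any characteristic, $A=F[h,X]/(X^2-hX)$ with $\deg h=\deg X=2$, $Y:=X-h$. $A$ is a Frobenius $F[h]$-algebra with the usual multiplication $m$ and unit, counit $\epsilon(1)=0,\ \epsilon(X)=1$, comultiplication $\Delta(1)=1\otimes X+X\otimes 1-h(1\otimes 1)$, $\Delta(X)=X\otimes X$. For an oriented link diagram $D$ with $n_+$ positive and $n_-$ negative crossings, $C=\mathit{CKh}_h(D;F)$ is the Khovanov complex obtained from $A$: a vertex $v$ of the cube of resolutions with $k$ circles contributes $A^{\otimes k}$ (tensor over $F[h]$) in homological degree $|v|-n_-$, and an element $x$ there has quantum grading $\mathrm{gr}_q(x)=\deg(x)-k-|v|-n_++2n_-$; the differential is the sum over edges of $\pm m$, $\pm\Delta$. Its homology is $\mathit{Kh}_h(D;F)$. For a marked point $p$ on $D$, $C_X\subset C$ (resp. $C_Y$) is the subcomplex spanned by elements whose factor on the circle containing $p$ is $X$ (resp. $Y$); these are isomorphic, and the reduced complex is either one of them, with quantum grading shifted by $-1$. Its homology is $\widetilde{\mathit{Kh}}_h(D;F)$. Cycles of the reduced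 complex are regarded as cycles of $C$. $\mathrm{Tor}$ denotes the $F[h]$-torsion submodule. Let $\widehat\sigma$ be the $F$-linear involution with $\widehat\sigma(h)=-h$, $\widehat\sigma(X)=X-h$, extended as a ring involution of $A$ and factorwise to $A^{\otimes k}$; $\mathrm{id}-\widehat\sigma$ is divisible by $h$ and $\widehat\nu:=(\mathrm{id}-\widehat\sigma)/h$, which is an $F[h^2]$-linear chain endomorphism of $C$. For a knot $K$ it is known that $\mathit{Kh}_h(K;F)\cong q^{-s-1}F[h]\oplus q^{-s+1}F[h]\oplus\mathrm{Tor}$ and $\widetilde{\mathit{Kh}}_h(K;F)\cong q^{-\tilde s}F[h]\oplus\mathrm{Tor}$, with free parts in homological degree $0$, where $q^{a}F[h]$ denotes a free module with generator in quantum grading $a$. One sets $s^F(K):=s$ and $\tilde s^F(K):=\tilde s$. *)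

(* Defs.v *)
From HB Require Import structures.
From mathcomp Require Import all_boot all_order all_algebra.
From mathcomp Require Import qpoly.

Set Implicit Arguments.
Unset Strict Implicit.
Unset Printing Implicit Defensive.

Import Order.TTheory GRing.Theory Num.Theory.
Local Open Scope ring_scope.

(** * Oriented link diagrams *)

(* A planar-diagram code.  The half-edges at crossing [i] are numbered
   0, 1, 2, 3 (in Z/4) counterclockwise, starting from the incoming end of the
   under-strand; [pd_arc i k] is the arc of the diagram that contains the k-th
   half-edge.  The under-strand runs from 0 to 2; the over-strand runs from
   3 to 1 at a positive crossing and from 1 to 3 at a negative one.  An arc
   that contains no half-edge is a crossingless component. *)
Record pd_code := PDCode {
  ncross : nat;
  narcs : nat;
  pd_arc : 'I_ncross -> 'I_4 -> 'I_narcs;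
  positive : pred 'I_ncross
}.

Definition dart (D : pd_code) : finType := ('I_(ncross D) * 'I_4)%type.

Definition dart_arc (D : pd_code) (d : dart D) : 'I_(narcs D) := pd_arc d.1 d.2.

Definition outgoing (D : pd_code) (d : dart D) : bool :=
  (d.2 == 2) || (d.2 == if positive d.1 then 1 else 3).

(* Every arc has either one initial and one terminal half-edge, or none. *)
Definition well_oriented (D : pd_code) : bool :=
  [forall a : 'I_(narcs D),
    (#|[set d : dart D | dart_arc d == a & outgoing d]| <= 1)%N &&
    (#|[set d : dart D | dart_arc d == a & outgoing d]| ==
     #|[set d : dart D | dart_arc d == a & ~~ outgoing d]|)].

Definition node_turn (D : pd_code) (d : dart D) : dart D := (d.1, d.2 + 1).

Definition edge_flip (D : pd_code) (d : dart D) : dart D :=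
  odflt d [pick d' | (d' != d) && (dart_arc d' == dart_arc d)].

Definition face_turn (D : pd_code) (d : dart D) : dart D :=
  node_turn (edge_flip d).

Definition shadow_adj (D : pd_code) : rel (dart D) :=
  fun d d' => (edge_flip d == d') || (node_turn d == d').

(* Euler's formula V - E + F = 2c for the 4-valent graph underlying the
   diagram, c being its number of connected components; #|dart D| = 2E.  As no
   component has V - E + F > 2, this says that all components have genus 0. *)
Definition planar (D : pd_code) : bool :=
  ((n_comp (@shadow_adj D) predT).*2 + #|{: dart D}| ==
   fcard (@edge_flip D) predT + fcard (@node_turn D) predT
   + fcard (@face_turn D) predT)%N.

Record link_diagram := LinkDiagram {
  code :> pd_code;
  code_well_oriented : well_oriented code;
  code_planar : planar code
}.

(* Arcs are glued at the crossings according to [f]. *)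
Definition glue (D : pd_code) (f : dart D -> dart D) : rel 'I_(narcs D) :=
  fun a b => [exists d, (dart_arc d == a) && (dart_arc (f d) == b)].

Definition ncomponents (D : pd_code) : nat :=
  n_comp (glue (fun d : dart D => (d.1, d.2 + 2))) predT.

Definition is_knot (D : link_diagram) : bool := ncomponents D == 1%N.

Definition nplus (D : pd_code) : nat := #|[pred i | @positive D i]|.
Definition nminus (D : pd_code) : nat := #|[pred i | ~~ @positive D i]|.

(** * The cube of resolutions *)

Definition vertex (D : pd_code) : finType := {ffun 'I_(ncross D) -> bool}.

Definition weight (D : pd_code) (v : vertex D) : nat := #|[pred i | v i]|.

(* The 0-smoothing joins the half-edges 0-1 and 2-3 (the oriented smoothing of
   a positive crossing); the 1-smoothing joins 0-3 and 1-2. *)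
Definition smoothing (D : pd_code) (v : vertex D) (d : dart D) : dart D :=
  (d.1, if v d.1 then 3 - d.2 else 1 - d.2).

Definition resolution (D : pd_code) (v : vertex D) : rel 'I_(narcs D) :=
  glue (smoothing v).

Definition same_circle (D : pd_code) (v : vertex D) : rel 'I_(narcs D) :=
  connect (resolution v).

Definition ncircles (D : pd_code) (v : vertex D) : nat :=
  n_comp (resolution v) predT.

(** * The Frobenius algebra *)

Section FrobeniusAlgebra.
Variable F : fieldType.

Definition hvar : {poly F} := 'X.

Definition frob_rel : {poly {poly F}} := 'X^2 - hvar *: 'X.

Local Notation frob := {poly %/ frob_rel}.

Definition Xfrob : frob := 'qX.
Definition Yfrob : frob := Xfrob - hvar *: 1.

(* The F[h]-basis (1, X) of A is indexed by [bool], [true] standing for X. *)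
Definition frob_basis (b : bool) : frob := if b then Xfrob else 1.
Definition frob_coef (x : frob) (b : bool) : {poly F} := (x : {poly {poly F}})`_b.

(* [mul_coef a b c] is the coordinate of m(e_a (x) e_b) on e_c. *)
Definition mul_coef (a b c : bool) : {poly F} :=
  frob_coef (frob_basis a * frob_basis b) c.

Definition tensor_coef (x y : frob) (b c : bool) : {poly F} :=
  frob_coef x b * frob_coef y c.

(* [comul_coef a b c] is the coordinate of Delta(e_a) on e_b (x) e_c. *)
Definition comul_coef (a b c : bool) : {poly F} :=
  if a then tensor_coef Xfrob Xfrob b c
  else tensor_coef 1 Xfrob b c + tensor_coef Xfrob 1 b c
       - hvar * tensor_coef 1 1 b c.

Definition sigma_h (r : {poly F}) : {poly F} := r \Po (- hvar).

Definition sigma_frob (x : frob) : frob :=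
  sigma_h (frob_coef x false) *: 1 + sigma_h (frob_coef x true) *: Yfrob.

End FrobeniusAlgebra.

Notation frob F := {poly %/ frob_rel F}.

Section FrobeniusAlgebraTheory.
Variable F : fieldType.

Lemma size_frob_rel : size (frob_rel F) = 3.
Proof.
rewrite size_polyDl ?size_polyXn // size_polyN.
by rewrite (leq_ltn_trans (size_scale_leq _ _)) ?size_polyX.
Qed.

Lemma monic_frob_rel : frob_rel F \is monic.
Proof.
rewrite monicE lead_coefDl ?lead_coefXn // size_polyXn size_polyN.
by rewrite (leq_ltn_trans (size_scale_leq _ _)) ?size_polyX.
Qed.

Lemma mk_monic_frob_rel : mk_monic (frob_rel F) = frob_rel F.
Proof. by rewrite /mk_monic size_frob_rel monic_frob_rel. Qed.

Lemma XfrobE : Xfrob F = 'X :> {poly {poly F}}.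
Proof. by apply: qpolyXE; rewrite ?size_frob_rel ?monic_frob_rel. Qed.

Lemma sqr_Xfrob : Xfrob F ^+ 2 = hvar F *: Xfrob F.
Proof.
apply/eqP; rewrite -subr_eq0 /Xfrob /qpolyX -rmorphXn -linearZ -linearB.
by apply/eqP/val_inj; rewrite /= mk_monic_frob_rel Pdiv.RingMonic.rmodpp ?monic_frob_rel.
Qed.

Lemma frob_coef_basis a b : frob_coef (frob_basis F a) b = (a == b)%:R.
Proof.
rewrite /frob_coef; case: a; rewrite /frob_basis ?XfrobE ?coefX ?coef1; by case: b.
Qed.

Lemma frob_coefZ c (x : frob F) b : frob_coef (c *: x) b = c * frob_coef x b.
Proof. exact: coefZ. Qed.

Lemma frob_coefD (x y : frob F) b :
  frob_coef (x + y) b = frob_coef x b + frob_coef y b.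
Proof. exact: coefD. Qed.

Lemma frob_coefB (x y : frob F) b :
  frob_coef (x - y) b = frob_coef x b - frob_coef y b.
Proof. exact: coefB. Qed.

Lemma frob_coef1 b : frob_coef (1 : frob F) b = (~~ b)%:R.
Proof. by rewrite (frob_coef_basis false); case: b. Qed.

Lemma frob_coefX b : frob_coef (Xfrob F) b = b%:R.
Proof. by rewrite (frob_coef_basis true); case: b. Qed.

Lemma mul_coefE a b c :
  mul_coef F a b c =
    if a && b then if c then hvar F else 0 else (c == a || b)%:R.
Proof.
rewrite /mul_coef; case: a b => [] []; rewrite /frob_basis ?mul1r ?mulr1 ?andbT ?andbF.
  by rewrite -expr2 sqr_Xfrob frob_coefZ frob_coefX; case: c; rewrite ?mulr1 ?mulr0.
all: by rewrite ?frob_coefX ?frob_coef1; case: c.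
Qed.

Lemma comul_coefE a b c :
  comul_coef F a b c =
    if a then (b && c)%:R else if b || c then (~~ (b && c))%:R else - hvar F.
Proof.
rewrite /comul_coef /tensor_coef !frob_coef1 !frob_coefX.
by case: a b c => [] [] []; 
  rewrite ?(mulr0, mul0r, mulr1, mul1r, addr0, add0r, subr0, sub0r, oppr0).
Qed.

Lemma frobE (x : frob F) :
  x = frob_coef x false *: 1 + frob_coef x true *: Xfrob F.
Proof.
set y := RHS.
have xy b : frob_coef x b = frob_coef y b.
  rewrite frob_coefD !frob_coefZ frob_coef1 frob_coefX.
  by case: b; rewrite ?mulr1 ?mulr0 ?addr0 ?add0r.
have sz (z : frob F) : (size z <= 2)%N.
  by rewrite -ltnS (leq_trans (size_mk_monic z)) // mk_monic_frob_rel size_frob_rel.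
apply/val_inj/polyP=> -[|[|i]]; [exact: (xy false) | exact: (xy true) |].
by rewrite !nth_default // (leq_trans (sz _)).
Qed.

Lemma sigma_frob_basis a b :
  frob_coef (sigma_frob (frob_basis F a)) b =
    (a == b)%:R - (a && ~~ b)%:R * hvar F.
Proof.
rewrite /sigma_frob !frob_coef_basis /sigma_h !rmorph_nat.
rewrite frob_coefD !frob_coefZ frob_coefB frob_coefZ !frob_coef1 !frob_coefX.
by case: a b => [] [] /=;
  rewrite ?(mulr0, mul0r, mulr1, mul1r, addr0, add0r, subr0, sub0r, oppr0).
Qed.

End FrobeniusAlgebraTheory.

(** * The Khovanov complex *)

(* The F[h]-module at a vertex [v] is free on the tensor products of basis
   elements 1 and X of A, that is, on the labellings of the circles of [v];
   such a labelling is encoded as a labelling of the arcs that is constant on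
   circles. *)
Definition compatible (D : pd_code)
    (s : vertex D * {ffun 'I_(narcs D) -> bool}) : bool :=
  [forall a, forall b, same_circle s.1 a b ==> (s.2 a == s.2 b)].

Definition state (D : pd_code) : finType :=
  {s : vertex D * {ffun 'I_(narcs D) -> bool} | compatible s}.

Definition svertex (D : pd_code) (s : state D) : vertex D := (val s).1.
Definition slabel (D : pd_code) (s : state D) : 'I_(narcs D) -> bool :=
  (val s).2.

Definition nX (D : pd_code) (s : state D) : nat :=
  #|[pred a | roots (resolution (svertex s)) a & slabel s a]|.

Section StateTheory.
Variable D : pd_code.

Lemma resolution_sym (v : vertex D) : connect_sym (resolution v).
Proof.
apply: sym_connect_sym => a b.
have sK : involutive (smoothing v).
  move=> [i k]; rewrite /smoothing /=; congr (_, _).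
  by case: (v i); rewrite opprB addrC subrK.
apply/existsP/existsP => -[d /andP[/eqP da /eqP db]];
  by exists (smoothing v d); rewrite sK da db !eqxx.
Qed.

Lemma eq_state (s t : state D) : svertex s = svertex t ->
  (forall a, roots (resolution (svertex s)) a -> slabel s a = slabel t a) ->
  s = t.
Proof.
case: s t => [[v l] cs] [[w m] ct]; rewrite /svertex /slabel /= => evw.
subst w => H; apply/val_inj => /=; congr (_, _); apply/ffunP => a.
have rep (f : {ffun 'I_(narcs D) -> bool}) :
    compatible (v, f) -> f a = f (fingraph.root (resolution v) a).
  move/forallP/(_ a)/forallP/(_ (fingraph.root (resolution v) a))/implyP.
  by move/(_ (connect_root _ _))/eqP.
by rewrite (rep _ cs) (rep _ ct) H // (roots_root (@resolution_sym v)).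
Qed.

End StateTheory.

(* The direct sum of the modules of all the vertices of the cube. *)
Notation CKh F D := {ffun state D -> {poly F}^o}.

Section Complex.
Variables (F : fieldType) (D : pd_code).
Local Notation R := {poly F}.
Local Notation A := (frob F).
Local Notation CKh := (CKh F D).

(* The pure tensor at [v] whose factor on each circle c of [v] is the value of
   [x] at the chosen representative arc of c. *)
Definition pure_tensor (v : vertex D) (x : 'I_(narcs D) -> A) : CKh :=
  [ffun t : state D => if svertex t == v then
     \prod_(a | roots (resolution v) a) frob_coef (x a) (slabel t a) else 0].

(* The matrix coefficient, from [s] to [t], of the edge map that changes the
   smoothing of crossing [i] from 0 to 1.  The circles of [s] through [i] are
   those of the arcs 0 and 2; if they differ they merge into a single circle,
   otherwise that circle splits into the circles of the arcs 0 and 2. *)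
Definition edge_coef (i : 'I_(ncross D)) (s t : state D) : R :=
  let v := svertex s in
  let a0 := pd_arc i 0 in
  let a2 := pd_arc i 2 in
  if [&& ~~ v i,
         svertex t == [ffun j => if j == i then true else v j]
       & [forall a, (~~ same_circle v a0 a && ~~ same_circle v a2 a)
                      ==> (slabel s a == slabel t a)]]
  then if same_circle v a0 a2
       then comul_coef F (slabel s a0) (slabel t a0) (slabel t a2)
       else mul_coef F (slabel s a0) (slabel s a2) (slabel t a0)
  else 0.

Definition edge_sign (i : 'I_(ncross D)) (v : vertex D) : R :=
  (-1) ^+ #|[pred j : 'I_(ncross D) | (j < i)%N && v j]|.

Definition ckh_diff (w : CKh) : CKh :=
  [ffun t => \sum_(s : state D) \sum_(i < ncross D)
     edge_sign i (svertex s) * edge_coef i s t * w s].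

Definition sigma_hat (w : CKh) : CKh :=
  \sum_(s : state D) sigma_h (w s) *:
    pure_tensor (svertex s) (fun a => sigma_frob (frob_basis F (slabel s a))).

(* The division by h is exact, see [nu_hatE]. *)
Definition nu_hat (w : CKh) : CKh :=
  [ffun s => (w - sigma_hat w) s %/ hvar F].

Lemma sigma_h0 (r : {poly F}) : (sigma_h r).[0] = r.[0].
Proof. by rewrite /sigma_h horner_comp hornerN hornerX oppr0. Qed.

Lemma sigma_hat0 (w : CKh) s : (sigma_hat w s : {poly F}).[0] = (w s : {poly F}).[0].
Proof.
have evB a b : (frob_coef (sigma_frob (frob_basis F a)) b).[0] = (a == b)%:R.
  rewrite sigma_frob_basis hornerD hornerN hornerM hornerX mulr0 subr0.
  by rewrite -polyC_natr hornerC.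
have evS (t : state D) :
    (pure_tensor (svertex t)
      (fun a => sigma_frob (frob_basis F (slabel t a))) s : {poly F}).[0]
    = (t == s)%:R.
  rewrite ffunE; case: eqP => [est|nst]; last first.
    by rewrite horner0; case: eqP => // ets; case: nst; rewrite ets.
  rewrite horner_prod; under eq_bigr do rewrite evB.
  case: eqP => [->|nst]; first by rewrite big1 // => a _; rewrite eqxx.
  have [/forallP ets|/forallPn[a]] := boolP
    [forall a, roots (resolution (svertex t)) a ==> (slabel t a == slabel s a)].
    case: nst; apply: eq_state => // a ra.
    by apply/eqP; move/implyP: (ets a); apply.
  rewrite negb_imply => /andP[ra /negPf nab].
  by rewrite (bigD1 a) //= nab mul0r.
have -> : sigma_hat w s = \sum_t sigma_h (w t) * (pure_tensor (svertex t)
      (fun a => sigma_frob (frob_basis F (slabel t a))) s : {poly F}).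
  by rewrite /sigma_hat sum_ffunE; apply: eq_bigr => t _; rewrite ffunE.
rewrite horner_sum (bigD1 s) //= hornerM evS eqxx mulr1 sigma_h0.
rewrite big1 ?addr0 // => t /negPf ts.
by rewrite hornerM evS ts mulr0.
Qed.

Lemma nu_hatE (w : CKh) : hvar F *: nu_hat w = w - sigma_hat w.
Proof.
apply/ffunP => s; rewrite ffunE [nu_hat w s]ffunE.
have : hvar F %| (w - sigma_hat w) s.
  rewrite /hvar -['X]subr0 -[0]/(0%:P) dvdp_XsubCl; apply/rootP.
  by rewrite !ffunE hornerD hornerN sigma_hat0 subrr.
by rewrite -[RHS]/((w - sigma_hat w) s : {poly F}) => /divpK {2}<-; rewrite mulrC.
Qed.

(** ** Gradings *)

Definition hdeg (s : state D) : int :=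
  (weight (svertex s))%:Z - (nminus D)%:Z.

(* gr_q of h^k times the basis element [s]; recall deg h = deg X = 2. *)
Definition qdeg (k : nat) (s : state D) : int :=
  (2 * k + 2 * nX s)%N%:Z - (ncircles (svertex s))%:Z
  - (weight (svertex s))%:Z - (nplus D)%:Z + 2 * (nminus D)%:Z.

Definition homogeneous (i j : int) (w : CKh) : Prop :=
  forall (s : state D) (k : nat),
    (w s : R)`_k != 0 -> hdeg s = i /\ qdeg k s = j.

(** ** Subcomplexes and their homology modulo torsion *)

Definition full_complex : CKh -> Prop := fun=> True.

(* The F[h]-span of the pure tensors whose factor on the circle of [p] is
   [u]; by multilinearity the other factors can be taken in {1, X}. *)
Definition marked_complex (p : 'I_(narcs D)) (u : A) (w : CKh) : Prop :=
  exists c : state D -> R,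
    w = \sum_(s : state D) c s *:
          pure_tensor (svertex s) (fun a =>
            if same_circle (svertex s) p a then u
            else frob_basis F (slabel s a)).

(* C_X if [b] is true and C_Y otherwise. *)
Definition reduced_complex (p : 'I_(narcs D)) (b : bool) : CKh -> Prop :=
  marked_complex p (if b then Xfrob F else Yfrob F).

Section Homology.
Variable S : CKh -> Prop.

Definition is_cycle (z : CKh) : Prop := S z /\ ckh_diff z = 0.

Definition is_boundary (z : CKh) : Prop := exists2 y, S y & z = ckh_diff y.

(* The homology class of the cycle [z] lies in Tor. *)
Definition torsion_class (z : CKh) : Prop :=
  exists2 r : R, r != 0 & is_boundary (r *: z).

(* The entries of [b] are cycles of S, and their classes form a basis of the
   F[h]-module H(S)/Tor. *)
Definition basis_mod_torsion (k : nat) (b : k.-tuple CKh) : Prop :=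
  [/\ forall i, is_cycle (tnth b i),
      forall z, is_cycle z -> exists c : 'I_k -> R,
        torsion_class (z - \sum_(i < k) c i *: tnth b i)
    & forall c : 'I_k -> R,
        torsion_class (\sum_(i < k) c i *: tnth b i) -> forall i, c i = 0].

End Homology.

(* Kh_h(D) = q^(-s-1) F[h] (+) q^(-s+1) F[h] (+) Tor, the free part being
   generated by the classes of [x] and [y], in homological degree 0. *)
Definition has_s (s : int) : Prop :=
  exists x y : CKh,
    [/\ homogeneous 0 (- s - 1) x, homogeneous 0 (- s + 1) y
      & basis_mod_torsion full_complex [tuple x; y]].

(* The reduced homology is q^(-s) F[h] (+) Tor; the reduced quantum grading is
   gr_q - 1. *)
Definition has_reduced_s (p : 'I_(narcs D)) (b : bool) (s : int) : Prop :=
  exists2 x : CKh, homogeneous 0 (- s + 1) x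
    & basis_mod_torsion (reduced_complex p b) [tuple x].

End Complex.

(* Main.v *)
(* Let U and V be the multiplications by X and Y at the marked point, ordered so
   that the reduced generator z lies in the image of U, and write
   sigma for the involution and nu = (id - sigma) / h.  One has U - V = +-h,
   U V = 0 and sigma U = V sigma, all commuting with the differential.  If w is
   a cycle of the unreduced complex, then U w, U sigma(w) and U nu(w) are
   multiples of z modulo torsion; combined with +-h w = U w - V w this expresses
   h w through z and h nu(z) with coefficients divisible by h, so z and nu(z)
   span.  Applying V shows that they are independent.

   The commutation relations are checked on the tensors of X and Y, which span
   over F[h, 1/h] and on which an edge of the cube acts by a scalar.  This
   needs every edge to merge or split circles, which is where planarity enters:
   on a sphere the half-edges can be given alternating signs, so that circles
   are coherently oriented.

   Finally nu lowers the q-degree by 2, and two homogeneous bases of the free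
   rank two quotient, of degrees (m, m + 2) and (n, n + 2), have m = n. *)

Require Import Defs.
From mathcomp Require Import all_boot all_order all_algebra.
From mathcomp Require Import fingroup perm ring zify.

Set Implicit Arguments.
Unset Strict Implicit.
Unset Printing Implicit Defensive.

Import Order.TTheory GRing.Theory Num.Theory.
Local Open Scope ring_scope.

(** * Alternating signs on a spherical map *)

Section ExactByDimension.
Variables (F : fieldType) (T1 T2 T3 C C' : finType).
Variables (A : T1 -> T2 -> F) (B : T2 -> T3 -> F).

Definition fun_mx (U V : finType) (K : U -> V -> F) : 'M[F]_(#|U|, #|V|) :=
  \matrix_(i, j) K (enum_val i) (enum_val j).

Definition fun_rV (U : finType) (g : U -> F) : 'rV[F]_#|U| :=
  \row_i g (enum_val i).

Lemma fun_rV_mul (U V : finType) (K : U -> V -> F) g :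
  fun_rV g *m fun_mx K = fun_rV (fun j => \sum_i g i * K i j).
Proof.
apply/rowP => j; rewrite !mxE [RHS](reindex_onto enum_val enum_rank) /=; last first.
  by move=> i _; rewrite enum_rankK.
by apply: eq_big => i; rewrite ?enum_valK ?eqxx // => _; rewrite !mxE.
Qed.

Lemma fun_rV_surj (U : finType) (g : 'rV[F]_#|U|) :
  g = fun_rV (fun i => g 0 (enum_rank i)).
Proof. by apply/rowP => j; rewrite !mxE enum_valK. Qed.

Lemma fun_rV0 (U : finType) (g : U -> F) : fun_rV g = 0 <-> g =1 fun=> 0.
Proof.
split=> [g0 i | g0]; last by apply/rowP => i; rewrite !mxE g0.
by move/rowP/(_ (enum_rank i)): g0; rewrite !mxE enum_rankK.
Qed.

(** The vectors [g] with [g K = 0] inject into F^W by restriction along [iota], so the left kernel,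
    of dimension |U| - rank K, has dimension at most |W|. *)
Lemma fun_mx_rank_ge (U V W : finType) (K : U -> V -> F) (iota : W -> U) :
  (forall g, (forall j, \sum_i g i * K i j = 0) ->
     (forall c, g (iota c) = 0) -> g =1 fun=> 0) ->
  (#|U| <= \rank (fun_mx K) + #|W|)%N.
Proof.
move=> injK; pose rho := fun_mx (fun i c => (i == iota c)%:R).
have := mxrank_mul_ker (kermx (fun_mx K)) rho.
have -> : (kermx (fun_mx K) :&: kermx rho)%MS = 0.
  apply/eqP; rewrite -submx0; apply/rV_subP => g; rewrite sub_capmx !sub_kermx.
  rewrite (fun_rV_surj g) !fun_rV_mul => /andP[/eqP/fun_rV0 gK /eqP/fun_rV0 g0].
  suff -> : fun_rV (fun i => g 0 (enum_rank i)) = 0 by exact: sub0mx.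
  apply/fun_rV0/injK => [|c]; first exact: gK.
  rewrite -[RHS](g0 c) (bigD1 (iota c)) //= eqxx mulr1 big1 ?addr0 // => i.
  by move=> /negPf ->; rewrite mulr0.
rewrite mxrank0 addn0 mxrank_ker => rk; rewrite -leq_subLR -rk.
exact: rank_leq_col.
Qed.

(* Exactness at T2 of the complex F^T1 -> F^T2 -> F^T3, by counting
   dimensions. *)
Lemma exact_of_card (iota : C -> T1) (iota' : C' -> T3) (y : T2 -> F) :
  (forall g k, \sum_j (\sum_i g i * A i j) * B j k = 0) ->
  (forall g, (forall j, \sum_i g i * A i j = 0) ->
     (forall c, g (iota c) = 0) -> g =1 fun=> 0) ->
  (forall x, (forall j, \sum_k x k * B j k = 0) ->
     (forall c, x (iota' c) = 0) -> x =1 fun=> 0) ->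
  (#|T2| + #|C| + #|C'| <= #|T1| + #|T3|)%N ->
  (forall k, \sum_j y j * B j k = 0) ->
  exists g, forall j, y j = \sum_i g i * A i j.
Proof.
move=> AB0 /fun_mx_rank_ge rkA /fun_mx_rank_ge rkB cardT yB0.
have trB : (fun_mx B)^T = fun_mx (fun k j => B j k) by apply/matrixP=> i j; rewrite !mxE.
rewrite -trB mxrank_tr in rkB.
have sAB : (fun_mx A <= kermx (fun_mx B))%MS.
  apply/rV_subP => _ /submxP[g ->]; rewrite sub_kermx (fun_rV_surj g) !fun_rV_mul.
  by apply/eqP/fun_rV0 => k; exact: AB0.
have sBA : (kermx (fun_mx B) <= fun_mx A)%MS.
  (* A subspace of equal rank is the whole space; the missing inequality |T2| - rank B <= rank A
     combines the cardinality hypothesis with both rank bounds. *)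
  rewrite -(mxrank_leqif_sup sAB) mxrank_ker eqn_leq.
  have := mxrankS sAB; rewrite mxrank_ker => -> /=.
  rewrite leq_subLR [X in (_ <= X)%N]addnC -(leq_add2r (#|C| + #|C'|)) addnA.
  by rewrite (leq_trans cardT) // addnACA leq_add.
have : (fun_rV y <= fun_mx A)%MS.
  by apply: submx_trans sBA; rewrite sub_kermx fun_rV_mul; apply/eqP/fun_rV0.
case/submxP => g; rewrite (fun_rV_surj g) fun_rV_mul => /rowP yE.
exists (fun i => g 0 (enum_rank i)) => j.
by have := yE (enum_rank j); rewrite !mxE !enum_rankK.
Qed.

End ExactByDimension.

(** * Half-edges of an oriented diagram and the involution along arcs *)

Section Darts.
Variable D : link_diagram.
Local Notation dart := (dart D).

(** Well-orientedness allows each arc at most one outgoing half-edge and equally many incoming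
    ones. *)
Lemma arc_out_unique (d d' : dart) :
  dart_arc d = dart_arc d' -> outgoing d = outgoing d' -> d = d'.
Proof.
move=> eqa eqo; have /forallP/(_ (dart_arc d))/andP[le1 /eqP eqn] := code_well_oriented D.
case od : (outgoing d) in eqo.
  by apply: (card_le1_eqP le1); rewrite inE ?eqa ?eqxx ?od -?eqo.
move: le1; rewrite eqn => le1.
by apply: (card_le1_eqP le1); rewrite inE ?eqa ?eqxx ?od -?eqo.
Qed.

(** Incoming and outgoing ends of an arc are equally many, so [d] has a partner of the opposite
    direction and the default value of [edge_flip] never occurs. *)
Lemma edge_flip_spec (d : dart) :
  dart_arc (edge_flip d) = dart_arc d /\ outgoing (edge_flip d) = ~~ outgoing d.
Proof.
have [d' arcd' outd'] : exists2 d', dart_arc d' = dart_arc d & outgoing d' = ~~ outgoing d.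
  have /forallP/(_ (dart_arc d))/andP[_ /eqP eqn] := code_well_oriented D.
  case od : (outgoing d).
    have : (0 < #|[set e : dart | dart_arc e == dart_arc d & ~~ outgoing e]|)%N.
      by rewrite -eqn; apply/card_gt0P; exists d; rewrite inE eqxx od.
    by case/card_gt0P => e; rewrite inE => /andP[/eqP ? /negPf ?]; exists e.
  have : (0 < #|[set e : dart | dart_arc e == dart_arc d & outgoing e]|)%N.
    by rewrite eqn; apply/card_gt0P; exists d; rewrite inE eqxx od.
  by case/card_gt0P => e; rewrite inE => /andP[/eqP ? ?]; exists e.
rewrite /edge_flip; case: pickP => [e /andP[ned /eqP arce] | /(_ d')] /=.
  split=> //; have : outgoing e != outgoing d.
    by apply: contraNneq ned => eqo; apply/eqP/arc_out_unique.
  by case: outgoing; case: outgoing.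
by rewrite arcd' eqxx andbT => /negbFE/eqP e; move: outd'; rewrite e; case: outgoing.
Qed.

Lemma dart_arc_edge_flip (d : dart) : dart_arc (edge_flip d) = dart_arc d.
Proof. by case: (edge_flip_spec d). Qed.

Lemma outgoing_edge_flip (d : dart) : outgoing (edge_flip d) = ~~ outgoing d.
Proof. by case: (edge_flip_spec d). Qed.

Lemma edge_flipK : involutive (@edge_flip D).
Proof.
move=> d; apply: arc_out_unique; first by rewrite !dart_arc_edge_flip.
by rewrite !outgoing_edge_flip negbK.
Qed.

Lemma dart_arc_eq (d d' : dart) :
  dart_arc d = dart_arc d' -> d' = d \/ d' = edge_flip d.
Proof.
move=> eqa; have [eqo|neqo] := eqVneq (outgoing d) (outgoing d').
  by left; apply/esym/arc_out_unique.
right; apply: arc_out_unique; first by rewrite dart_arc_edge_flip.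
by rewrite outgoing_edge_flip; case: (outgoing d) (outgoing d') neqo => [] [].
Qed.

Lemma node_turn_inj : injective (@node_turn D).
Proof.
move=> [i k] [j l] /eqP; rewrite xpair_eqE /= (inj_eq (addIr _)).
by case/andP=> /eqP -> /eqP ->.
Qed.

Lemma edge_flip_inj : injective (@edge_flip D).
Proof. exact: can_inj edge_flipK. Qed.

(** [shadow_adj] has forward steps only; as both maps are injective on a finite set, iterating the
    same map undoes a step. *)
Lemma shadow_sym : connect_sym (@shadow_adj D).
Proof.
have symf (f : dart -> dart) : injective f ->
    subrel (frel f) (@shadow_adj D) -> forall d, connect (@shadow_adj D) (f d) d.
  move=> injf sub d; apply: (@connect_sub _ (frel f)).
    by move=> x y /sub; apply: connect1.
  by rewrite fconnect_sym // fconnect1.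
have sym d d' : connect (@shadow_adj D) d d' -> connect (@shadow_adj D) d' d.
  case/connectP => q; elim: q d => [d _ ->|e q IHq d] //=.
  case/andP=> /orP[]/eqP de /IHq{}IHq /IHq /connect_trans; apply; rewrite -de;
    apply: symf => [|x y /eqP <-]; rewrite /shadow_adj ?eqxx ?orbT //.
    exact: edge_flip_inj.
  exact: node_turn_inj.
by move=> d d'; apply/idP/idP; apply: sym.
Qed.

End Darts.

(** * Cellular cohomology of spherical maps with coefficients in F_2 *)

Section SphericalMap.
Variables (T : finType) (N E Q : T -> T) (S : rel T).
Local Notation F2 := 'F_2.

Hypotheses (N_inj : injective N) (EK : involutive E).
Hypothesis QE : forall d, Q d = N (E d).
Hypothesis S_sym : connect_sym S.
Hypothesis SE : forall d d', S d d' = (E d == d') || (N d == d').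
Hypothesis sumN : forall x : T -> F2, (forall d, x (N d) = x d) -> \sum_d x d = 0.
Hypothesis sumE : forall x : T -> F2, (forall d, x (E d) = x d) -> \sum_d x d = 0.
Hypothesis euler : ((n_comp S predT).*2 + #|T| =
  fcard E predT + fcard N predT + fcard Q predT)%N.

Local Notation class_of e := {d : T | roots e d}.
Local Notation nodes := (class_of (frel N)).
Local Notation edges := (class_of (frel E)).
Local Notation faces := (class_of (frel Q)).
Local Notation pieces := (class_of S).

Let E_inj : injective E.
Proof. exact: can_inj EK. Qed.

Let Q_inj : injective Q.
Proof. by move=> d d'; rewrite !QE => /N_inj/E_inj. Qed.

Let addFF (x : F2) : x + x = 0.
Proof. exact: (addrr_pchar2 (pchar_Fp (isT : prime 2))). Qed.

Let eqFF (x y : F2) : x + y = 0 -> x = y.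
Proof. by move/eqP; rewrite addr_eq0 (oppr_pchar2 (pchar_Fp (isT : prime 2))) => /eqP. Qed.

(** The matrix of the first coboundary of a 2-complex with the darts as 0-cells. Its 2-cells are the
    orbits of N, E and Q; the boundary of a Q-orbit runs from [d] to [E d] and on to
    [N (E d) = Q d]. *)
Let coboundary (d0 : T) (j : T + T) : F2 :=
  match j with
  | inl d => (d == d0)%:R + (N d == d0)%:R
  | inr d => (d == d0)%:R + (E d == d0)%:R
  end.

(* The sum of a 1-cochain along the boundary of a 2-cell; [inl d] is the
   1-cell from [d] to [N d] and [inr d] the one to [E d]. *)
Let circulation (j : T + T) (k : nodes + edges + faces) : F2 :=
  match j, k with
  | inl d, inl (inl r) => (froot N d == val r)%:R
  | inl d, inl (inr r) => 0
  | inl d, inr r => (froot Q (E d) == val r)%:R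
  | inr d, inl (inl r) => 0
  | inr d, inl (inr r) => (froot E d == val r)%:R
  | inr d, inr r => (froot Q d == val r)%:R
  end.

Let sum_delta (I : finType) (f : I -> F2) (x : I) : \sum_y f y * (x == y)%:R = f x.
Proof.
rewrite (bigD1 x) //= eqxx mulr1 big1 ?addr0 // => y.
by rewrite eq_sym => /negPf ->; rewrite mulr0.
Qed.

Let sum_root (e : rel T) (sym : connect_sym e) (x : class_of e -> F2) d :
  \sum_k x k * (fingraph.root e d == val k)%:R =
    x (exist _ (fingraph.root e d) (roots_root sym d)).
Proof. by rewrite -[RHS]sum_delta; apply: eq_bigr => k _; rewrite -val_eqE. Qed.

Let symN := fconnect_sym N_inj.
Let symE := fconnect_sym E_inj.
Let symF := fconnect_sym Q_inj.

Let rootS (f : T -> T) (injf : injective f) d : froot f (f d) = froot f d.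
Proof.
by apply/eqP; rewrite (root_connect (fconnect_sym injf)) fconnect_sym // fconnect1.
Qed.

Let cobE (g : T -> F2) j : \sum_i g i * coboundary i j =
  match j with
  | inl d => g d + g (N d)
  | inr d => g d + g (E d)
  end.
Proof.
by case: j => d /=; under eq_bigr do rewrite mulrDr; rewrite big_split /= !sum_delta.
Qed.

Let cob_circ (g : T -> F2) k :
  \sum_j (\sum_i g i * coboundary i j) * circulation j k = 0.
Proof.
under eq_bigr do rewrite cobE.
rewrite big_sumType /=; case: k => [[r|r]|r] /=.
- under [X in _ + X]eq_bigr do rewrite mulr0.
  rewrite [X in _ + X]big1 // addr0.
  under eq_bigr do rewrite mulrDl.
  rewrite big_split /= [X in X + _](reindex_inj N_inj) /=.
  by under eq_bigr do rewrite (rootS N_inj); rewrite addFF.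
- under eq_bigr do rewrite mulr0.
  rewrite big1 // add0r; under eq_bigr do rewrite mulrDl.
  rewrite big_split /= [X in X + _](reindex_inj E_inj) /=.
  by under eq_bigr do rewrite (rootS E_inj); rewrite addFF.
under eq_bigr do rewrite mulrDl.
under [X in _ + X]eq_bigr do rewrite mulrDl.
(* Reindexed by N and E, the last two sums cancel the second and the first, because [N d = Q (E d)]
   has the same Q-root as [E d]. *)
rewrite !big_split /= [X in _ + (X + _)](reindex_inj N_inj) /=.
rewrite [X in _ + (_ + X)](reindex_inj E_inj) /=.
under [X in _ + (_ + X)]eq_bigr do rewrite EK.
under [X in _ + (X + _)]eq_bigr => d _.
  rewrite -{2}[d]EK -QE (rootS Q_inj (E d)); over.
by rewrite [X in _ + X]addrC addrACA addFF addFF addr0.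
Qed.

(** Around nodes and edges the length is even by [sumN] and [sumE]; the boundary of a face takes one
    N-step for each E-step. *)
Let circ_const k : \sum_j circulation j k = 0.
Proof.
rewrite big_sumType /=; case: k => [[r|r]|r] /=.
- rewrite [X in _ + X]big1 // addr0; apply: sumN => d.
  by rewrite (rootS N_inj).
- rewrite big1 // add0r; apply: sumE => d.
  by rewrite (rootS E_inj).
by rewrite [X in _ + X](reindex_inj E_inj) /= addFF.
Qed.

Let shadow_const (x : T -> F2) :
  (forall d, x (N d) = x d) -> (forall d, x (E d) = x d) ->
  forall d, x (fingraph.root S d) = x d.
Proof.
move=> xN xE d; have /connectP[q] := connect_root S d.
elim: q d (fingraph.root _ d) => [d _ _ -> //|d' q IHq d r] /=.
by rewrite SE => /andP[/orP[]/eqP <- pq] /(IHq _ _ pq) ->.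
Qed.

Let class_root e (sym : connect_sym e) (d : T) : class_of e :=
  exist (fun d : T => roots e d) _ (roots_root sym d).

(** A 0-cocycle is constant on connected pieces, hence determined by its values at their roots. *)
Let cob_ker (g : T -> F2) : (forall j, \sum_i g i * coboundary i j = 0) ->
  (forall c : pieces, g (val c) = 0) -> g =1 fun=> 0.
Proof.
move=> g0 gr d.
have gN e : g (N e) = g e by apply/esym/eqFF; rewrite -(g0 (inl e)) cobE.
have gE e : g (E e) = g e by apply/esym/eqFF; rewrite -(g0 (inr e)) cobE.
rewrite -(shadow_const gN gE d).
exact: (gr (class_root S_sym d)).
Qed.

Let class_rootK e (sym : connect_sym e) (r : class_of e) : class_root sym (val r) = r.
Proof. by apply/val_inj/eqP/(valP r). Qed.

Let class_rootS f (injf : injective f) (d : T) :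
  class_root (fconnect_sym injf) (f d) = class_root (fconnect_sym injf) d.
Proof. exact/val_inj/rootS. Qed.

Let circE (x : nodes + edges + faces -> F2) j : \sum_k x k * circulation j k =
  match j with
  | inl d => x (inl (inl (class_root symN d))) + x (inr (class_root symF (E d)))
  | inr d => x (inl (inr (class_root symE d))) + x (inr (class_root symF d))
  end.
Proof.
rewrite !big_sumType; case: j => d /=.
  rewrite [X in _ + X + _]big1 ?addr0 => [|k _]; last by rewrite mulr0.
  congr (_ + _); first exact: (sum_root symN (fun k => x (inl (inl k)))).
  exact: (sum_root symF (fun k => x (inr k))).
rewrite [X in X + _ + _]big1 ?add0r => [|k _]; last by rewrite mulr0.
congr (_ + _); first exact: (sum_root symE (fun k => x (inl (inr k)))).
exact: (sum_root symF (fun k => x (inr k))).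
Qed.

(** A 2-cycle takes the same value on the two 2-cells that meet in a 1-cell, so on each piece it is
    a multiple of the fundamental class and a single face detects it. Here [z d] is its value on the
    face of [d]. *)
Let circ_ker (x : nodes + edges + faces -> F2) :
  (forall j, \sum_k x k * circulation j k = 0) ->
  (forall c : pieces, x (inr (class_root symF (val c))) = 0) -> x =1 fun=> 0.
Proof.
move=> x0 xr; pose z d := x (inr (class_root symF d)).
have xN d : x (inl (inl (class_root symN d))) = z (E d).
  by apply: eqFF; rewrite -(x0 (inl d)) circE.
have xE d : x (inl (inr (class_root symE d))) = z d.
  by apply: eqFF; rewrite -(x0 (inr d)) circE.
have zE d : z (E d) = z d by rewrite -!xE class_rootS.
have zN d : z (N d) = z d by rewrite -zE -xN class_rootS xN zE.
have z0 d : z d = 0.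
  by rewrite -(shadow_const zN zE) -(xr (class_root S_sym d)).
case=> [[r|r]|r]; rewrite -(class_rootK _ r); [rewrite xN | rewrite xE |]; exact: z0.
Qed.

(** Euler's formula with |T| 0-cells and 2|T| 1-cells; each piece counts twice, for one class in
    degree 0 and one in degree 2. *)
Let card_cells :
  (#|{: T + T}| + #|{: pieces}| + #|{: pieces}| <=
   #|T| + #|{: nodes + edges + faces}|)%N.
Proof.
have cardC (e : rel T) : #|{: class_of e}| = n_comp e predT.
  by rewrite card_sig; apply: eq_card => d; rewrite !inE andbT.
have := euler.
rewrite card_sum [in X in (_ <= X)%N]card_sum [in X in (_ <= X)%N]card_sum.
have cN := cardC (frel N); have cE := cardC (frel E).
have cF := cardC (frel Q); have cS := cardC S.
move: cN cE cF cS.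
move: #|{: nodes}| #|{: edges}| #|{: faces}| #|{: pieces}| => n1 n2 n3 n4 -> -> -> ->.
lia.
Qed.

(* The 1-cochain that is constant 1 has even circulation around every 2-cell;
   on a sphere it is therefore a coboundary. *)
Lemma alternating_map : exists eps : T -> bool,
  (forall d, eps (N d) = ~~ eps d) /\ (forall d, eps (E d) = ~~ eps d).
Proof.
have circ1 k : \sum_j 1 * circulation j k = 0.
  by under eq_bigr do rewrite mul1r; apply: circ_const.
have [g gE] := exact_of_card cob_circ cob_ker circ_ker card_cells circ1.
have flip (x y : F2) : 1 = x + y -> (y != 0) = ~~ (x != 0).
  by case: x y => [[|[|?]] ?] // [[|[|?]] ?] // /eqP.
exists (fun d => g d != 0); split=> d; apply: flip.
  by rewrite (gE (inl d)) cobE.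
by rewrite (gE (inr d)) cobE.
Qed.

End SphericalMap.

(** A node orbit has four half-edges, and [edge_flip] pairs outgoing half-edges with incoming ones,
    so both parity conditions hold. *)
Lemma alternating_darts (D : link_diagram) : exists eps : dart D -> bool,
  (forall d, eps (node_turn d) = ~~ eps d) /\
  (forall d, eps (edge_flip d) = ~~ eps d).
Proof.
have addFF (x : 'F_2) : x + x = 0 by exact: (addrr_pchar2 (pchar_Fp (isT : prime 2))).
apply: (@alternating_map _ _ _ (@face_turn D) (@shadow_adj D)) => //.
- exact: node_turn_inj.
- exact: edge_flipK.
- exact: shadow_sym.
- move=> x xN; rewrite (eq_bigr (fun d => x (d.1, d.2))) => [|[] //].
  rewrite -(pair_bigA _ (fun i k => x (i, k))) /=; apply: big1 => i _.
  have xS k : x (i, k + 1) = x (i, k) := xN (i, k).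
  rewrite !big_ord_recl big_ord0.
  have e1 : lift ord0 ord0 = ord0 + 1 :> 'I_4 by apply/val_inj.
  have e2 : lift ord0 (lift ord0 ord0) = ord0 + 1 + 1 :> 'I_4 by apply/val_inj.
  have e3 : lift ord0 (lift ord0 (lift ord0 ord0)) = ord0 + 1 + 1 + 1 :> 'I_4.
    by apply/val_inj.
  by rewrite e1 e2 e3 !xS addr0 [X in _ + X]addrA addFF add0r addFF.
- move=> x xE; rewrite (bigID (@outgoing D)) /= (reindex_inj (@edge_flip_inj D)) /=.
  under eq_bigl do rewrite outgoing_edge_flip.
  by under eq_bigr do rewrite xE; rewrite addFF.
exact/eqP/code_planar.
Qed.

(** * Circles and resmoothing *)

Section Bifurcation.
Variable D : link_diagram.
Local Notation dart := (dart D).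
Implicit Types (v w : vertex D) (d : dart) (a b : 'I_(narcs D)).

Lemma smoothingK v : involutive (smoothing v).
Proof.
by move=> [i k]; rewrite /smoothing /=; case: (v i); rewrite opprB addrC subrK.
Qed.

Lemma same_circle_refl v a : same_circle v a a.
Proof. exact: connect0. Qed.

Lemma same_circle_sym v a b : same_circle v a b = same_circle v b a.
Proof. exact: resolution_sym. Qed.

Lemma same_circle_trans v a b c :
  same_circle v a b -> same_circle v b c -> same_circle v a c.
Proof. exact: connect_trans. Qed.

Lemma same_circle_congr v a b c : same_circle v a b -> same_circle v a c = same_circle v b c.
Proof. by move=> ab; apply: (same_connect (@resolution_sym D v) ab). Qed.

Lemma same_circle_smoothing v d :
  same_circle v (dart_arc d) (dart_arc (smoothing v d)).
Proof. by apply: connect1; apply/existsP; exists d; rewrite !eqxx. Qed.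

Lemma same_circle_closed v (P : pred 'I_(narcs D)) a b :
  (forall d, P (dart_arc d) -> P (dart_arc (smoothing v d))) ->
  same_circle v a b -> P a -> P b.
Proof.
move=> Pcl /connectP[q]; elim: q a => [a _ -> //|c q IHq a] /=.
case/andP=> /existsP[d /andP[/eqP da /eqP dc]] qP bE Pa.
by apply: IHq qP bE _; rewrite -dc Pcl // da.
Qed.

Section Alternating.
Variables (eps : dart -> bool).
Hypothesis eps_node : forall d, eps (node_turn d) = ~~ eps d.
Hypothesis eps_edge : forall d, eps (edge_flip d) = ~~ eps d.

Let eps_odd i (k : 'I_4) : eps (i, k) = odd k (+) eps (i, 0).
Proof.
case: k => k lk; elim: k lk => [|k IHk] lk; first by congr (eps (i, _)); apply/val_inj.
have lk' : (k < 4)%N by exact: ltnW.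
rewrite /= addNb -(IHk lk') -eps_node; congr (eps (i, _)).
by apply/val_inj; rewrite /= addn1 modn_small.
Qed.

(** Both smoothings pair half-edges of opposite parity, so smoothing and then flipping preserves the
    sign. *)
Let eps_smoothing v d : eps (smoothing v d) = ~~ eps d.
Proof.
case: d => i k; rewrite /smoothing /= eps_odd [eps (i, k)]eps_odd -addNb.
by congr (_ (+) _); case: (v i); case: k => [[|[|[|[|]]]]].
Qed.

(** Stepping from darts of one sign only, and fixing the others, traverses each circle through a
    crossing in a single direction and makes it one cycle. *)
Let half v d := if eps d then edge_flip (smoothing v d) else d.

Let eps_half v d : eps (half v d) = eps d.
Proof. by rewrite /half; case: ifP => // ed; rewrite eps_edge eps_smoothing ed. Qed.

Let half_inj v : injective (half v).
Proof.
move=> d d' eqh; have := congr1 eps eqh; rewrite !eps_half => eqe; move: eqh.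
by rewrite /half eqe; case: ifP => // _ /(@edge_flip_inj D) /(can_inj (smoothingK v)).
Qed.

Let halfp v := perm (@half_inj v).

Let same_circle_porbit v d d' : eps d -> eps d' ->
  same_circle v (dart_arc d) (dart_arc d') = (d' \in porbit (halfp v) d).
Proof.
move=> ed ed'; apply/idP/porbitP => [|[n ->]]; last first.
  elim: n => [|n IHn]; first by rewrite expg0 perm1 same_circle_refl.
  rewrite expgSr permM permE; move: IHn; move: ((halfp v ^+ n)%g d) => e IHn.
  rewrite /half; case: ifP => // _; rewrite dart_arc_edge_flip.
  exact: same_circle_trans IHn (same_circle_smoothing v e).
move: ed; pose P a := [exists e, [&& eps e, dart_arc e == a & e \in porbit (halfp v) d]].
move=> ed /(@same_circle_closed v P) PP; apply/porbitP.
have /existsP[e /and3P[ee /eqP ae oe]] : P (dart_arc d'); last first.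
  case: (dart_arc_eq ae) => [-> //|d'E].
  by move: ed'; rewrite d'E eps_edge ee.
apply: PP => [e /existsP[f /and3P[ef /eqP af orb]]|]; last first.
  by apply/existsP; exists d; rewrite ed eqxx porbit_id.
have porbitS x : porbit (halfp v) (halfp v x) = porbit (halfp v) x.
  by rewrite -{2}[halfp v]expg1 porbit_perm.
(* If [e] is [f] itself, the walk moves one step forward; if [e] is the other end of the arc, it
   moves one step back, from [f] to [smoothing v e]. *)
case: (dart_arc_eq af) => eE.
  apply/existsP; exists (halfp v f).
  rewrite -eq_porbit_mem porbitS eq_porbit_mem orb.
  by rewrite permE eps_half ef eE /half ef dart_arc_edge_flip eqxx.
apply/existsP; exists (smoothing v e).
have ee : eps (smoothing v e) by rewrite eps_smoothing eE eps_edge ef.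
rewrite ee eqxx -eq_porbit_mem -porbitS permE /half ee smoothingK eE edge_flipK.
by rewrite eq_porbit_mem.
Qed.

Lemma bifurcation_eps v w i :
  (forall j, j != i -> v j = w j) -> w i = ~~ v i -> eps (i, 0) ->
  same_circle w (pd_arc i 0) (pd_arc i 2) = ~~ same_circle v (pd_arc i 0) (pd_arc i 2).
Proof.
move=> vw wi e0; have e2 : eps (i, 2) by rewrite eps_odd e0.
(* The darts 0 and 2 are the only positive ones at crossing [i], and changing the smoothing
   exchanges their images. *)
have wE : halfp w = (tperm (i, 0) (i, 2) * halfp v)%g.
  apply/permP => d; rewrite permM [LHS]permE [RHS]permE /half.
  case: (tpermP (i, 0) (i, 2) d) => [->|->|/eqP d0 /eqP d2].
  - rewrite e0 e2; congr edge_flip; rewrite /smoothing /= wi.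
    by case: (v i) => /=; congr pair; apply/val_inj.
  - rewrite e0 e2; congr edge_flip; rewrite /smoothing /= wi.
    by case: (v i) => /=; congr pair; apply/val_inj.
  case: ifP => // ed; congr edge_flip; rewrite /smoothing.
  have [di|ndi] := eqVneq d.1 i; last by rewrite vw.
  case: d d0 d2 ed di => j k /=; rewrite eps_odd => d0 d2 ed ji; subst j.
  rewrite e0 addbT in ed; move: d0 d2 ed; rewrite !xpair_eqE eqxx /=.
  by case: k => [[|[|[|[|]]]]].
rewrite !(same_circle_porbit _ e0 e2) wE.
have n02 : (i, 0) != (i, 2) :> dart by rewrite xpair_eqE eqxx.
(* A transposition changes the number of cycles by one, upwards if the two darts share a cycle and
   downwards otherwise. Going from [v] to [w] and back must restore the count, so they share a cycle
   in exactly one of the two. *)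
have := porbits_mul_tperm (halfp v) (i, 2) (i, 0).
have := porbits_mul_tperm (tperm (i, 0) (i, 2) * halfp v)%g (i, 2) (i, 0).
rewrite /= [tperm (i, 2) _]tpermC mulgA tperm2 mul1g eq_sym n02.
move: #|_| #|_| => m n; case: (_ \in _); case: (_ \in _) => //=; lia.
Qed.

End Alternating.

(* Darts of either sign are permuted by [d |-> edge_flip (smoothing v d)], the
   cycles of this permutation being the circles of [v]; resmoothing a crossing
   composes it with a transposition. *)
Lemma same_circle_flip v w i :
  (forall j, j != i -> v j = w j) -> w i = ~~ v i ->
  same_circle w (pd_arc i 0) (pd_arc i 2) = ~~ same_circle v (pd_arc i 0) (pd_arc i 2).
Proof.
move=> vw wi; have [eps [epsN epsE]] := alternating_darts D.
have bif := bifurcation_eps epsN epsE vw wi.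
have [/bif //|ne0] := boolP (eps (i, 0)).
by apply: (@bifurcation_eps (fun d => ~~ eps d)) vw wi ne0 => d; rewrite ?epsN ?epsE.
Qed.

Definition touched v i a :=
  same_circle v (pd_arc i 0) a || same_circle v (pd_arc i 2) a.

Lemma touched_same_circle v i a b : same_circle v a b -> touched v i a = touched v i b.
Proof.
by move=> ab; rewrite /touched !(same_circle_sym v (pd_arc i _)) !(same_circle_congr _ ab).
Qed.

(** Either smoothing joins the half-edges 1 and 3 to 0 and 2, so the arcs 0 and 2 represent all
    circles at the crossing. *)
Lemma touched_crossing v i k : touched v i (pd_arc i k).
Proof.
have := same_circle_smoothing v (i, k).
rewrite /dart_arc /smoothing /touched /= ![same_circle v (pd_arc i _) (pd_arc i k)]same_circle_sym.
have [|||] : [\/ k = 0, k = 1, k = 2 | k = 3].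
- by case: k => [[|[|[|[|]]]]] // lk; [constructor 1 | constructor 2 |
    constructor 3 | constructor 4]; apply/val_inj.
- by move=> -> _; rewrite same_circle_refl.
- move=> ->; have -> : 3 - 1 = 2 :> 'I_4 by apply/val_inj.
  by rewrite subrr; case: (v i) => ->; rewrite ?orbT.
- by move=> -> _; rewrite same_circle_refl orbT.
move=> ->; have -> : 1 - 3 = 2 :> 'I_4 by apply/val_inj.
by rewrite subrr; case: (v i) => ->; rewrite ?orbT.
Qed.

Lemma same_circle_touched v i a b :
  same_circle v (pd_arc i 0) (pd_arc i 2) -> touched v i a -> touched v i b ->
  same_circle v a b.
Proof.
move=> s02; rewrite /touched -!(same_circle_congr _ s02) !orbb => s0a.
by rewrite (same_circle_congr _ s0a).
Qed.

(** Both inclusions follow from closure under smoothing steps: away from [i] the two smoothings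
    agree, and at [i] all four ends are touched and lie on one circle of [w]. *)
Lemma same_circle_merge v w i a b :
  (forall j, j != i -> v j = w j) -> same_circle w (pd_arc i 0) (pd_arc i 2) ->
  same_circle w a b = same_circle v a b || touched v i a && touched v i b.
Proof.
move=> vw s02.
have sub x y : same_circle v x y -> same_circle w x y.
  move/(@same_circle_closed v (same_circle w x)); apply; last exact: same_circle_refl.
  move=> d xd; apply: same_circle_trans xd _.
  have [di|ndi] := eqVneq d.1 i.
    by apply: (same_circle_touched s02); rewrite /dart_arc /= di touched_crossing.
  have -> : smoothing v d = smoothing w d by rewrite /smoothing vw.
  exact: same_circle_smoothing.
apply/idP/idP => [|/orP[/sub //|/andP[]]].
- move/(@same_circle_closed w (fun b => same_circle v a b || touched v i a && touched v i b)).
  apply=> [d|]; last by rewrite same_circle_refl.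
  have [di|ndi] := eqVneq d.1 i.
    have td : touched v i (dart_arc d) by rewrite /dart_arc di touched_crossing.
    have -> : touched v i (dart_arc (smoothing w d)).
      by rewrite /dart_arc /= di touched_crossing.
    rewrite td !andbT => /orP[/touched_same_circle|] ->; rewrite ?td ?orbT //.
  have -> : smoothing w d = smoothing v d by rewrite /smoothing vw.
  have sd := same_circle_smoothing v d.
  rewrite -(touched_same_circle i sd) => /orP[ad|->]; last by rewrite orbT.
  by rewrite (same_circle_trans ad sd).
have tw x : touched v i x -> touched w i x.
  by rewrite /touched => /orP[]/sub ->; rewrite ?orbT.
by move=> /tw ta /tw; apply: same_circle_touched.
Qed.

End Bifurcation.

(** * Sums and products over circles, at a crossing and away from it *)

Section Circles.
Variable D : link_diagram.
Implicit Types (v w : vertex D) (a b : 'I_(narcs D)) (i : 'I_(ncross D)).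

Local Notation croot v := (fingraph.root (resolution v)).
Local Notation croots v := (roots (resolution v)).

Definition constant_on_circles (T : Type) v (g : 'I_(narcs D) -> T) :=
  forall a b, same_circle v a b -> g a = g b.

Lemma croot_circle v a : same_circle v a (croot v a).
Proof. exact: connect_root. Qed.

Lemma croots_croot v a : croots v (croot v a).
Proof. exact: roots_root (@resolution_sym D v) a. Qed.

Lemma croots_circle v a b : croots v b -> (b == croot v a) = same_circle v a b.
Proof.
move=> /eqP {1}<-; rewrite (root_connect (@resolution_sym D v)).
exact: same_circle_sym.
Qed.

(** One or two circles pass through the crossing, represented by the arcs 0 and 2. A general
    operation serves both the products of coordinates and the sums of degrees. *)
Lemma big_circles_split (R : Type) (idx : R) (op : Monoid.com_law idx)
    (g : 'I_(narcs D) -> R) v i :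
  constant_on_circles v g ->
  \big[op/idx]_(a | croots v a) g a =
  op (if same_circle v (pd_arc i 0) (pd_arc i 2) then g (pd_arc i 0)
      else op (g (pd_arc i 0)) (g (pd_arc i 2)))
     (\big[op/idx]_(a | croots v a && ~~ touched v i a) g a).
Proof.
move=> gv; rewrite (bigID (touched v i)) /=; congr (op _ _).
rewrite (bigD1 (croot v (pd_arc i 0))) /=; last first.
  by rewrite croots_croot -(touched_same_circle i (croot_circle _ _)) touched_crossing.
rewrite -(gv _ _ (croot_circle v (pd_arc i 0))); case: ifP => s02.
  rewrite big1 ?Monoid.mulm1 // => a /andP[/andP[ra ta]].
  rewrite croots_circle // => /negP[]; move: ta.
  by rewrite /touched -(same_circle_congr _ s02) orbb.
congr (op _ _); rewrite (gv _ _ (croot_circle v (pd_arc i 2))).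
apply: big_pred1 => a; have [ra|nra] /= := boolP (croots v a); last first.
  by apply/esym; apply: contraNF nra => /eqP ->; apply: croots_croot.
rewrite !croots_circle // /touched; case s0a : same_circle => /=; last by rewrite andbT.
apply/esym; apply: contraFF s02 => s2a.
by rewrite (same_circle_trans s0a) // same_circle_sym.
Qed.

Lemma untouched_merge v w i :
  (forall j, j != i -> v j = w j) -> same_circle w (pd_arc i 0) (pd_arc i 2) ->
  (fun a => croots v a && ~~ touched v i a) =1 (fun a => croots w a && ~~ touched w i a).
Proof.
move=> vw s02 a; have tE : touched w i a = touched v i a.
  rewrite /touched -(same_circle_congr _ s02) orbb (same_circle_merge _ _ vw s02).
  by rewrite touched_crossing /touched; case: (same_circle v (pd_arc i 0) a).
rewrite tE; case ta : (touched v i a); rewrite ?andbF // !andbT.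
rewrite /roots /fingraph.root; congr (odflt _ _ == _); apply: eq_pick => b.
by have := same_circle_merge a b vw s02; rewrite ta orbF => /esym.
Qed.

(** By [same_circle_flip] the crossing lies on a single circle in one of the two resolutions, and
    [untouched_merge] applies in that direction. *)
Lemma untouched_flip v w i : (forall j, j != i -> v j = w j) -> w i = ~~ v i ->
  (fun a => croots v a && ~~ touched v i a) =1 (fun a => croots w a && ~~ touched w i a).
Proof.
move=> vw wi; case s02 : (same_circle w (pd_arc i 0) (pd_arc i 2)).
  exact: untouched_merge vw s02.
move=> a; rewrite [RHS](@untouched_merge w v i) // => [j /vw //|].
by have := same_circle_flip vw wi; rewrite s02 => /esym/negbFE.
Qed.

Lemma untouched_circle v w i a b : (forall j, j != i -> v j = w j) -> w i = ~~ v i ->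
  ~~ touched v i a -> same_circle v a b = same_circle w a b.
Proof.
move=> vw wi ta; case s02 : (same_circle w (pd_arc i 0) (pd_arc i 2)).
  by rewrite (same_circle_merge _ _ vw s02) (negPf ta) orbF.
have wv j : j != i -> w j = v j by move/vw.
have s02v : same_circle v (pd_arc i 0) (pd_arc i 2).
  by have := same_circle_flip vw wi; rewrite s02 => /esym/negbFE.
rewrite (same_circle_merge _ _ wv s02v).
have -> : touched w i a = false; last by rewrite orbF.
apply: contraNF ta; rewrite /touched !(same_circle_merge _ _ wv s02v).
by case/orP=> ->; rewrite ?orbT.
Qed.

Lemma exists_state v (l : 'I_(narcs D) -> bool) : constant_on_circles v l ->
  exists s : state D, svertex s = v /\ slabel s =1 l.
Proof.
move=> lv; have comp : compatible (v, finfun l).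
  apply/forallP => a; apply/forallP => b; apply/implyP => /lv ab.
  by rewrite !ffunE ab.
exists (exist (fun s => compatible s) _ comp); split=> // a; rewrite /slabel /=; exact: ffunE.
Qed.

Lemma slabel_constant (s : state D) : constant_on_circles (svertex s) (slabel s).
Proof.
move=> a b ab; have /forallP/(_ a)/forallP/(_ b)/implyP/(_ ab)/eqP := valP s.
by [].
Qed.

End Circles.

(** * Pure tensors and induction on their factors *)

Section PureTensors.
Variables (F : fieldType) (D : link_diagram).
Local Notation R := {poly F}.
Local Notation A := (frob F).
Local Notation CKh := (CKh F D).
Local Notation h := (hvar F).
Local Notation arc := 'I_(narcs D).
Implicit Types (v w : vertex D) (x y z : arc -> A) (l : arc -> bool).

Local Notation croots v := (roots (resolution v)).

Definition basis_chain (s : state D) : CKh := [ffun t => (t == s)%:R].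

Lemma basis_chainE (s : state D) v : svertex s = v ->
  basis_chain s = pure_tensor v (fun a => frob_basis F (slabel s a)).
Proof.
move=> <-; apply/ffunP => t; rewrite !ffunE.
case: eqP => [-> | nts].
  by rewrite eqxx big1 // => a _; rewrite frob_coef_basis eqxx.
case: eqP => // vts.
have [/forallP eqts|/forallPn[a]] := boolP
    [forall a, croots (svertex s) a ==> (slabel t a == slabel s a)].
  case: nts; apply: eq_state => // a; rewrite vts => ra.
  by apply/eqP; move/implyP: (eqts a); apply.
rewrite negb_imply => /andP[ra /negPf nab].
by rewrite (bigD1 a) //= frob_coef_basis eq_sym nab mul0r.
Qed.

Lemma basis_chain_sum (w : CKh) : w = \sum_s w s *: basis_chain s.
Proof.
apply/ffunP => t; rewrite sum_ffunE (bigD1 t) //= big1 => [|s /negPf st].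
  by rewrite addr0 !ffunE eqxx [RHS]mulr1.
by rewrite !ffunE eq_sym st [LHS]mulr0.
Qed.

Lemma eq_pure_tensor v x y : (forall a, croots v a -> x a = y a) ->
  pure_tensor v x = pure_tensor v y.
Proof.
move=> xy; apply/ffunP => t; rewrite !ffunE; case: ifP => // _.
by apply: eq_bigr => a /xy ->.
Qed.

Lemma pure_tensor_lin v x y z r c d :
  croots v r -> x r = c *: y r + d *: z r ->
  (forall a, croots v a -> a != r -> x a = y a) ->
  (forall a, croots v a -> a != r -> x a = z a) ->
  pure_tensor v x = c *: pure_tensor v y + d *: pure_tensor v z.
Proof.
move=> rr xr xy xz; apply/ffunP => t; rewrite !ffunE; case: ifP => _; last first.
  by rewrite ![_ *: 0]mulr0 addr0.
rewrite !(bigD1 r rr) /= xr frob_coefD !frob_coefZ.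
have -> : \prod_(i | croots v i && (i != r)) frob_coef (y i) (slabel t i) =
          \prod_(i | croots v i && (i != r)) frob_coef (x i) (slabel t i).
  by apply: eq_bigr => a /andP[ra ar]; rewrite xy.
have -> : \prod_(i | croots v i && (i != r)) frob_coef (z i) (slabel t i) =
          \prod_(i | croots v i && (i != r)) frob_coef (x i) (slabel t i).
  by apply: eq_bigr => a /andP[ra ar]; rewrite xz.
by rewrite [in RHS]/GRing.scale /= mulrDl !mulrA.
Qed.

Definition update (T : Type) (x : arc -> T) r (u : T) a := if a == r then u else x a.

(** The exceptional factor [g] is replaced, slot by slot, by [e true] and [e false]. This serves to
    expand Y in terms of 1 and X, and h times 1 in terms of X and Y. *)
Lemma tensor_ind v (e : bool -> A) (g : A) (P : (arc -> A) -> Prop) :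
  (forall x, (forall a, croots v a -> exists b, x a = e b) -> P x) ->
  (forall x r, croots v r -> x r = g -> (forall b, P (update x r (e b))) -> P x) ->
  forall x, (forall a, croots v a -> x a = g \/ exists b, x a = e b) -> P x.
Proof.
move=> P0 PS x xP; pose s := enum 'I_(narcs D).
have : forall a, croots v a -> a \notin s -> exists b, x a = e b.
  by move=> a _; rewrite mem_enum.
elim: s x xP => [|r s IHs] x xP xs; first by apply: P0 => a ra; apply: xs.
have [rr|nrr] := boolP (croots v r); last first.
  apply: IHs => // a ra nas; apply: xs => //; rewrite inE negb_or nas andbT.
  by apply: contraNneq nrr => <-.
have [xg|[b xb]] := xP r rr; last first.
  apply: IHs => // a ra nas; have [->|nar] := eqVneq a r; first by exists b.
  by apply: xs => //; rewrite inE negb_or nas nar.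
apply: (PS x r) => // b; apply: IHs => [a ra|a ra nas]; rewrite /update.
  by case: eqP => _; [right; exists b | apply: xP].
case: (eqVneq a r) => [_|nar]; first by exists b.
by apply: xs => //; rewrite inE negb_or nas nar.
Qed.

End PureTensors.

(** * Tensors of X and Y *)

Section EigenTensors.
Variables (F : fieldType) (D : link_diagram).
Local Notation R := {poly F}.
Local Notation A := (frob F).
Local Notation CKh := (CKh F D).
Local Notation h := (hvar F).
Local Notation arc := 'I_(narcs D).
Local Notation croot v := (fingraph.root (resolution v)).
Local Notation croots v := (roots (resolution v)).
Implicit Types (v : vertex D) (w : CKh) (x y z : arc -> A) (l : arc -> bool).

Lemma hvar_neq0 : h != 0.
Proof. by rewrite polyX_eq0. Qed.

Lemma chain_scale_inj (c : R) (w w' : CKh) : c != 0 -> c *: w = c *: w' -> w = w'.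
Proof.
move=> c0 /ffunP e; apply/ffunP => s; apply: (mulfI c0).
by move: (e s); rewrite !ffunE.
Qed.

Definition XY (l : bool) : A := if l then Xfrob F else Yfrob F.

Lemma coef_XY (l b : bool) : frob_coef (XY l) b = if l then b%:R else if b then 1 else - h.
Proof.
case: l => /=; first by rewrite frob_coefX.
rewrite frob_coefB frob_coefZ frob_coefX frob_coef1.
by case: b; rewrite ?mulr0 ?subr0 // mulr1 sub0r.
Qed.

Definition tensorXY v l : CKh := pure_tensor v (fun a => XY (l a)).

(** With [tau] the identity this is F[h]-linearity; with the substitution of -h for h it covers
    [sigma_hat]. *)
Definition twisted_linear (tau : R -> R) (Phi : CKh -> CKh) :=
  forall c w w', Phi (c *: w + w') = tau c *: Phi w + Phi w'.

Section Semilinear.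
Variables (tau : {rmorphism R -> R}) (Phi : CKh -> CKh).
Hypothesis Phi_lin : twisted_linear tau Phi.

Lemma twisted_linear0 : Phi 0 = 0.
Proof.
have := Phi_lin 1 0 0; rewrite scaler0 addr0 rmorph1 scale1r => /eqP.
by rewrite -subr_eq0 opprD addrA subrr sub0r oppr_eq0 => /eqP.
Qed.

Lemma twisted_linearZ c w : Phi (c *: w) = tau c *: Phi w.
Proof. by have := Phi_lin c w 0; rewrite !addr0 twisted_linear0 addr0. Qed.

Lemma twisted_linearD w w' : Phi (w + w') = Phi w + Phi w'.
Proof. by have := Phi_lin 1 w w'; rewrite rmorph1 !scale1r. Qed.

Lemma twisted_linearN w : Phi (- w) = - Phi w.
Proof. by rewrite -scaleN1r twisted_linearZ rmorphN1 scaleN1r. Qed.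

Lemma twisted_linearB w w' : Phi (w - w') = Phi w - Phi w'.
Proof. by rewrite twisted_linearD twisted_linearN. Qed.

Lemma twisted_linear_sum (I : finType) (P : pred I) (w : I -> CKh) :
  Phi (\sum_(i | P i) w i) = \sum_(i | P i) Phi (w i).
Proof. exact: (big_morph Phi twisted_linearD twisted_linear0). Qed.

(* Y = X - h 1 expands a tensor of X and Y into basis chains. *)
Lemma twisted_linear_tensorXY v (f : arc -> A -> A) l :
  (forall s, svertex s = v ->
     Phi (basis_chain F s) = pure_tensor v (fun a => f a (frob_basis F (slabel s a)))) ->
  (forall a, f a (Yfrob F) = f a (Xfrob F) - tau h *: f a 1) ->
  Phi (tensorXY v l) = pure_tensor v (fun a => f a (XY (l a))).
Proof.
move=> Phi_basis fY; pose P x := Phi (pure_tensor v x) = pure_tensor v (fun a => f a (x a)).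
apply: (@tensor_ind _ _ v (frob_basis F) (Yfrob F) P) => [x xP|x r rr xr xP|a ra].
(* [x] is controlled at representatives only; reading the label off there makes [m] constant on
   circles. *)
- pose m a := frob_coef (x (croot v a)) true == 1.
  have mP a : croots v a -> x a = frob_basis F (m a).
    move=> ra; rewrite /m (eqP ra); have [b ->] := xP a ra.
    by rewrite frob_coef_basis; case: b; rewrite ?eqxx // eq_sym oner_eq0.
  have [|s [sv sm]] := @exists_state D v m.
    by move=> a b ab; rewrite /m (fingraph.rootP (@resolution_sym D v) ab).
  rewrite /P; have -> : pure_tensor v x = basis_chain F s.
    by rewrite (basis_chainE _ sv); apply: eq_pure_tensor => a /mP ->; rewrite sm.
  by rewrite Phi_basis //; apply: eq_pure_tensor => a /mP ->; rewrite sm.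
- rewrite /P (@pure_tensor_lin _ _ v x (update x r (frob_basis F true))
     (update x r (frob_basis F false)) r 1 (- h)) //.
  + rewrite twisted_linearD !twisted_linearZ !xP rmorph1 rmorphN.
    rewrite -(pure_tensor_lin (r := r) (x := fun a => f a (x a))) //.
    * by rewrite /update eqxx xr fY scale1r scaleNr.
    * by move=> a _ /negPf ar; rewrite /update ar.
    * by move=> a _ /negPf ar; rewrite /update ar.
  + by rewrite /update eqxx xr scale1r scaleNr.
  + by move=> a _ /negPf ar; rewrite /update ar.
  + by move=> a _ /negPf ar; rewrite /update ar.
by case: (l a); [right; exists true | left].
Qed.

End Semilinear.

(* Since h 1 = X - Y, the tensors of X and Y span up to powers of h. *)
Lemma twisted_linear_ext (tau : {rmorphism R -> R}) (Phi Psi : CKh -> CKh) :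
  tau h != 0 -> twisted_linear tau Phi -> twisted_linear tau Psi ->
  (forall v l, constant_on_circles v l -> Phi (tensorXY v l) = Psi (tensorXY v l)) ->
  Phi =1 Psi.
Proof.
move=> th0 Phi_lin Psi_lin eqT w; rewrite (basis_chain_sum w).
rewrite (twisted_linear_sum Phi_lin) (twisted_linear_sum Psi_lin); apply: eq_bigr => s _.
rewrite (twisted_linearZ Phi_lin) (twisted_linearZ Psi_lin); congr (_ *: _).
set v := svertex s; rewrite (basis_chainE _ (erefl v)).
pose P x := Phi (pure_tensor v x) = Psi (pure_tensor v x).
apply: (@tensor_ind _ _ v XY 1 P) => [x xP|x r rr xr xP|a ra].
- pose m a := frob_coef (x (croot v a)) false == 0.
  have mP a : croots v a -> x a = XY (m a).
    move=> ra; rewrite /m (eqP ra); have [b ->] := xP a ra; rewrite coef_XY.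
    by case: b; rewrite ?eqxx // oppr_eq0 (negPf hvar_neq0).
  rewrite /P (eq_pure_tensor mP); apply: eqT => a b ab.
  by rewrite /m (fingraph.rootP (@resolution_sym D v) ab).
- apply: (chain_scale_inj th0); rewrite -(twisted_linearZ Phi_lin) -(twisted_linearZ Psi_lin).
  have -> : h *: pure_tensor v x =
      pure_tensor v (update x r (XY true)) - pure_tensor v (update x r (XY false)).
    rewrite (@pure_tensor_lin _ _ v (update x r (XY true)) (update x r (XY false)) x r 1 h) //.
    + by rewrite scale1r addrC addKr.
    + by rewrite /update eqxx xr scale1r /= subrK.
    + by move=> a _ /negPf ar; rewrite /update ar.
    + by move=> a _ /negPf ar; rewrite /update ar.
  by rewrite (twisted_linearB Phi_lin) (twisted_linearB Psi_lin) !xP.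
by case: (slabel s a); [right; exists true | left].
Qed.

End EigenTensors.

(** * Marked multiplication and the involution on tensors of X and Y *)

Section Operators.
Variables (F : fieldType) (D : link_diagram).
Local Notation R := {poly F}.
Local Notation A := (frob F).
Local Notation CKh := (CKh F D).
Local Notation h := (hvar F).
Local Notation arc := 'I_(narcs D).
Local Notation croot v := (fingraph.root (resolution v)).
Local Notation croots v := (roots (resolution v)).
Implicit Types (v : vertex D) (w : CKh) (x y z : arc -> A) (l : arc -> bool).
Implicit Types (p a : arc) (b : bool).

(** X and Y are orthogonal, and idempotent up to the factors h and -h recorded here. *)
Definition eta b : R := if b then h else - h.

Lemma eta_neq0 b : eta b != 0.
Proof. by case: b; rewrite /eta ?oppr_eq0 hvar_neq0. Qed.

Lemma mul_XY b b' : XY F b * XY F b' = (if b == b' then eta b else 0) *: XY F b.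
Proof.
have XX := sqr_Xfrob F; rewrite expr2 in XX.
have XY0 : Xfrob F * Yfrob F = 0 by rewrite mulrBr XX -scalerAr mulr1 subrr.
case: b b' => [] [] /=; rewrite ?scale0r //.
  by rewrite mulrC.
rewrite {1}/Yfrob mulrBl XY0 sub0r -scalerAl mul1r scaleNr.
by [].
Qed.

Lemma pure_tensor_scale v p c x :
  pure_tensor v (fun a => if same_circle v p a then c *: x a else x a) =
  c *: pure_tensor v x.
Proof.
rewrite (@pure_tensor_lin _ _ v _ x x (croot v p) c 0) ?croots_croot //.
- by rewrite scale0r addr0.
- by rewrite croot_circle scale0r addr0.
- by move=> a ra; rewrite croots_circle // => /negPf ->.
- by move=> a ra; rewrite croots_circle // => /negPf ->.
Qed.

(** Multiplication by [u] on the tensor factor of the circle through [p]. For [u] equal to X or Y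
    its image is the reduced complex. *)
Definition mark p (u : A) w : CKh :=
  \sum_(s : state D) w s *: pure_tensor (svertex s) (fun a =>
    if same_circle (svertex s) p a then u * frob_basis F (slabel s a)
    else frob_basis F (slabel s a)).

Lemma sum_basis_chain (f : R -> R) (G : state D -> CKh) s :
  f 0 = 0 -> f 1 = 1 -> \sum_t f (basis_chain F s t) *: G t = G s.
Proof.
move=> f0 f1; rewrite (bigD1 s) //= ffunE eqxx f1 scale1r big1 ?addr0 // => t /negPf ts.
by rewrite ffunE ts f0 scale0r.
Qed.

Lemma mark_lin p u : twisted_linear idfun (mark p u).
Proof.
move=> c w w'; rewrite /mark scaler_sumr -big_split; apply: eq_bigr => s _ /=.
by rewrite !ffunE scalerDl scalerA.
Qed.

Lemma mark_basis p u v s : svertex s = v ->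
  mark p u (basis_chain F s) = pure_tensor v (fun a =>
    if same_circle v p a then u * frob_basis F (slabel s a) else frob_basis F (slabel s a)).
Proof. by move=> <-; apply: (@sum_basis_chain id). Qed.

Lemma mark_XY p b v l : constant_on_circles v l ->
  mark p (XY F b) (tensorXY F v l) = (if b == l p then eta b else 0) *: tensorXY F v l.
Proof.
move=> lv; rewrite (twisted_linear_tensorXY (tau := idfun) (mark_lin p (XY F b))
  (f := fun a (u : A) => if same_circle v p a then XY F b * u else u)).
- rewrite -(pure_tensor_scale v p); apply: eq_pure_tensor => a ra.
  by case: ifP => // /lv <-; rewrite mul_XY; case: eqP => [->|]; rewrite ?scale0r.
- by move=> s; apply: mark_basis.
by move=> a; case: ifP => // _; rewrite mulrBr -scalerAr.
Qed.


Let sigmaM : {rmorphism R -> R} := comp_poly (- h).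

Lemma sigma_hE r : sigma_h r = sigmaM r.
Proof. by []. Qed.

Lemma sigma_hvar : sigmaM h = - h.
Proof. exact: comp_polyX. Qed.

Lemma sigma_hK : involutive sigmaM.
Proof.
move=> r; rewrite /sigmaM /= -comp_polyA.
by rewrite rmorphN /= comp_polyX opprK comp_polyXr.
Qed.

Lemma sigma_eta b : sigmaM (eta b) = - eta b.
Proof. by case: b; rewrite /eta ?rmorphN /= sigma_hvar. Qed.

Lemma sigma_hat_lin : twisted_linear sigmaM (@sigma_hat F D).
Proof.
move=> c w w'; rewrite /sigma_hat scaler_sumr -big_split; apply: eq_bigr => s _ /=.
by rewrite !ffunE !sigma_hE rmorphD rmorphM scalerDl scalerA.
Qed.

Lemma sigma_XY b : sigma_frob (XY F b) = XY F (~~ b).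
Proof.
rewrite /sigma_frob !coef_XY !sigma_hE; case: b => /=.
  by rewrite rmorph0 rmorph1 scale0r scale1r add0r.
by rewrite rmorphN rmorph1 sigma_hvar opprK scale1r addrC subrK.
Qed.

Lemma sigma_hat_XY v l : sigma_hat (tensorXY F v l) = tensorXY F v (fun a => ~~ l a).
Proof.
rewrite (twisted_linear_tensorXY (tau := sigmaM) sigma_hat_lin (v := v)
  (f := fun _ => @sigma_frob F)).
- by apply: eq_pure_tensor => a _; rewrite sigma_XY.
- by move=> s <-; apply: (@sum_basis_chain sigmaM) => //; [exact: rmorph0 | exact: rmorph1].
move=> _; rewrite (sigma_XY false) (sigma_XY true) sigma_hvar /=.
rewrite /sigma_frob !frob_coef1 !sigma_hE rmorph0 rmorph1 scale1r scale0r addr0.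
by rewrite scaleNr opprK /Yfrob subrK.
Qed.

Lemma ckh_diff_lin : twisted_linear idfun (@ckh_diff F D).
Proof.
move=> c w w'; apply/ffunP => t; rewrite !ffunE scaler_sumr -big_split.
apply: eq_bigr => s _ /=; rewrite scaler_sumr -big_split.
by apply: eq_bigr => i _ /=; rewrite !ffunE mulrDr; congr (_ + _); apply: mulrCA.
Qed.

Definition set_crossing v (i : 'I_(ncross D)) : vertex D :=
  [ffun j => if j == i then true else v j].

(** Off the crossing, a source state of an edge into [t] is determined by [t]; only the labels of
    the one or two circles at the crossing stay free, which turns the sum over states into a sum
    over booleans. *)
Lemma sum_states_at (G : state D -> R) v (i : 'I_(ncross D)) t :
  ~~ v i -> svertex t = set_crossing v i ->
  (forall s, G s != 0 -> svertex s = v /\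
     forall a, ~~ touched v i a -> slabel s a = slabel t a) ->
  exists st : bool -> bool -> state D,
    [/\ forall b c, svertex (st b c) = v /\
          (forall a, ~~ touched v i a -> slabel (st b c) a = slabel t a),
        forall b c, slabel (st b c) (pd_arc i 0) = b,
        forall b c, slabel (st b c) (pd_arc i 2) =
          if same_circle v (pd_arc i 0) (pd_arc i 2) then b else c &
        \sum_s G s = if same_circle v (pd_arc i 0) (pd_arc i 2)
          then \sum_b G (st b b) else \sum_b \sum_c G (st b c)].
Proof.
move=> vi tv GP.
(* If the arcs 0 and 2 share a circle, the first branch wins and the label there is [b]. *)
pose l b c a := if same_circle v (pd_arc i 0) a then b
  else if same_circle v (pd_arc i 2) a then c else slabel t a.
have vt j : j != i -> v j = svertex t j by move=> /negPf ji; rewrite tv ffunE ji.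
have ti : svertex t i = ~~ v i by rewrite tv ffunE eqxx vi.
have lcst b c : constant_on_circles v (l b c).
  move=> x y xy; rewrite /l ![same_circle v (pd_arc i _) _]same_circle_sym.
  rewrite !(same_circle_congr _ xy); case: ifP => // y0; case: ifP => // y2.
  apply: slabel_constant; rewrite -(untouched_circle _ vt ti) //.
  rewrite (touched_same_circle i xy) /touched.
  by rewrite ![same_circle v (pd_arc i _) _]same_circle_sym y0 y2.
have st_ex b c : {s : state D | (svertex s == v) && [forall a, slabel s a == l b c a]}.
  apply/sigW; have [s [sv sl]] := exists_state (lcst b c).
  by exists s; rewrite sv eqxx /=; apply/forallP => a; rewrite sl.
pose st b c := sval (st_ex b c).
have stv b c : svertex (st b c) = v by case/andP: (svalP (st_ex b c)) => /eqP.
have stl b c a : slabel (st b c) a = l b c a.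
  by case/andP: (svalP (st_ex b c)) => _ /forallP/(_ a)/eqP.
have st0 b c : slabel (st b c) (pd_arc i 0) = b by rewrite stl /l same_circle_refl.
have st2 b c : slabel (st b c) (pd_arc i 2) =
    if same_circle v (pd_arc i 0) (pd_arc i 2) then b else c.
  by rewrite stl /l same_circle_refl.
exists st; split=> //.
  by move=> b c; split=> // a /norP[/negPf n0 /negPf n2]; rewrite stl /l n0 n2.
have stE s : G s != 0 -> s = st (slabel s (pd_arc i 0)) (slabel s (pd_arc i 2)).
  move=> /GP[sv su]; apply: eq_state => [|a _]; first by rewrite stv.
  have sc := slabel_constant (s := s); rewrite sv in sc.
  rewrite stl /l; case: ifP => [/sc //|n0]; case: ifP => [/sc //|n2].
  by rewrite su // /touched n0 n2.
case: ifP => s02.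
  rewrite (partition_big (fun s => slabel s (pd_arc i 0)) xpredT) //=.
  apply: eq_bigr => b _; rewrite (bigD1 (st b b)) /=; last by rewrite st0.
  rewrite big1 ?addr0 // => s /andP[/eqP sb ns]; apply: contraNeq ns => /[dup] G0 /stE ->.
  have sc := slabel_constant (s := s); have [sv _] := GP s G0; rewrite sv in sc.
  by rewrite -(sc _ _ s02) sb.
rewrite (partition_big (fun s => slabel s (pd_arc i 0)) xpredT) //=.
apply: eq_bigr => b _; rewrite (partition_big (fun s => slabel s (pd_arc i 2)) xpredT) //=.
apply: eq_bigr => c _; rewrite (bigD1 (st b c)) /=; last by rewrite st0 st2 s02 !eqxx.
rewrite big1 ?addr0 // => s /andP[/andP[/eqP sb /eqP sc] ns].
by apply: contraNeq ns => /stE ->; rewrite sb sc.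
Qed.

End Operators.

(** * The differential on tensors of X and Y *)

Section Differential.
Variables (F : fieldType) (D : link_diagram).
Local Notation R := {poly F}.
Local Notation A := (frob F).
Local Notation CKh := (CKh F D).
Local Notation h := (hvar F).
Local Notation arc := 'I_(narcs D).
Local Notation croots v := (roots (resolution v)).
Implicit Types (v : vertex D) (w : CKh) (l : arc -> bool) (i : 'I_(ncross D)).
Implicit Types (p a : arc) (b : bool) (s t : state D).

Lemma set_crossing_off v i j : j != i -> v j = set_crossing v i j.
Proof. by rewrite ffunE => /negPf ->. Qed.

Lemma set_crossing_on v i : ~~ v i -> set_crossing v i i = ~~ v i.
Proof. by rewrite ffunE eqxx => ->. Qed.

Lemma edge_coef_vertex i s t : edge_coef F i s t != 0 ->
  [/\ ~~ svertex s i, svertex t = set_crossing (svertex s) i &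
      forall a, ~~ touched (svertex s) i a -> slabel s a = slabel t a].
Proof.
rewrite /edge_coef; case: ifP => [/and3P[vi /eqP tv /forallP sl] _|]; last by rewrite eqxx.
split=> // a; rewrite /touched negb_or => ta.
by have /implyP/(_ ta)/eqP := sl a.
Qed.

Lemma edge_coefE i s t : ~~ svertex s i -> svertex t = set_crossing (svertex s) i ->
  (forall a, ~~ touched (svertex s) i a -> slabel s a = slabel t a) ->
  edge_coef F i s t =
    if same_circle (svertex s) (pd_arc i 0) (pd_arc i 2)
    then comul_coef F (slabel s (pd_arc i 0)) (slabel t (pd_arc i 0)) (slabel t (pd_arc i 2))
    else mul_coef F (slabel s (pd_arc i 0)) (slabel s (pd_arc i 2)) (slabel t (pd_arc i 0)).
Proof.
move=> vi tv sl; rewrite /edge_coef vi tv eqxx; case: ifP => // /forallPn[a].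
by rewrite negb_imply -negb_or => /andP[/sl ->]; rewrite eqxx.
Qed.

(** The scalar of an edge on a tensor of X and Y: Delta X = X (x) X and Delta Y = Y (x) Y, while m(X
    (x) X) = h X, m(Y (x) Y) = - h Y and m(X (x) Y) = 0. *)
Definition edge_factor v i l : R :=
  if same_circle v (pd_arc i 0) (pd_arc i 2) then 1
  else if l (pd_arc i 0) == l (pd_arc i 2) then eta F (l (pd_arc i 0)) else 0.

(** A split only refines the circles, and a merge with nonzero factor joins circles of equal
    label. *)
Lemma set_crossing_constant v i l : ~~ v i -> constant_on_circles v l ->
  edge_factor v i l != 0 -> constant_on_circles (set_crossing v i) l.
Proof.
move=> vi lv; have vw := @set_crossing_off v i; have wi := set_crossing_on vi.
have := same_circle_flip vw wi; rewrite /edge_factor; case: ifP => s02 w02.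
  have wv j (ji : j != i) : set_crossing v i j = v j by rewrite -vw.
  by move=> _ a b ab; apply: lv; rewrite (same_circle_merge _ _ wv s02) ab.
have [l02 _|_] := eqVneq (l (pd_arc i 0)) (l (pd_arc i 2)); last by rewrite eqxx.
have lt a : touched v i a -> l a = l (pd_arc i 0) by case/orP=> /lv // <-.
move=> a b; rewrite (same_circle_merge _ _ vw w02) => /orP[/lv //|/andP[/lt -> /lt ->]].
by [].
Qed.

Lemma edge_tensorXY v i l t : constant_on_circles v l -> ~~ v i ->
  \sum_s edge_coef F i s t * tensorXY F v l s =
  edge_factor v i l * tensorXY F (set_crossing v i) l t.
Proof.
move=> lv vi; have [tv|/eqP/negPf tv] := svertex t =P set_crossing v i; last first.
  rewrite [in RHS]ffunE tv mulr0 big1 // => s _; rewrite ffunE.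
  case: eqP => [sv|]; last by rewrite mulr0.
  have [-> |/edge_coef_vertex[_]] := eqVneq (edge_coef F i s t) 0; first by rewrite mul0r.
  by rewrite sv => /eqP; rewrite tv.
have [s|st [st_v st0 st2 ->]] := sum_states_at
    (G := fun s => edge_coef F i s t * tensorXY F v l s) vi tv _.
  rewrite mulf_eq0 negb_or => /andP[/edge_coef_vertex[_ _ sl]].
  by rewrite ffunE; have [sv _|] := eqVneq (svertex s) v; [rewrite sv in sl | rewrite eqxx].
have vw := @set_crossing_off v i; have wi := set_crossing_on vi.
have w02 := same_circle_flip vw wi.
(* The circles away from the crossing contribute the same factor before and after the edge. *)
pose rest := \prod_(a | croots v a && ~~ touched v i a)
  frob_coef (XY F (l a)) (slabel t a).
have T_st b c : tensorXY F v l (st b c) =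
    (if same_circle v (pd_arc i 0) (pd_arc i 2) then frob_coef (XY F (l (pd_arc i 0))) b
     else frob_coef (XY F (l (pd_arc i 0))) b * frob_coef (XY F (l (pd_arc i 2))) c) * rest.
  have [sv su] := st_v b c; rewrite ffunE sv eqxx (big_circles_split _ i); last first.
    move=> x y xy; rewrite (lv _ _ xy); congr frob_coef.
    by apply: slabel_constant; rewrite sv.
  rewrite /= st0 st2; congr (_ * _); first by case: same_circle.
  by apply: eq_bigr => a /andP[_ /su ->].
have T_t : edge_factor v i l != 0 -> tensorXY F (set_crossing v i) l t =
    (if ~~ same_circle v (pd_arc i 0) (pd_arc i 2)
     then frob_coef (XY F (l (pd_arc i 0))) (slabel t (pd_arc i 0))
     else frob_coef (XY F (l (pd_arc i 0))) (slabel t (pd_arc i 0)) *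
          frob_coef (XY F (l (pd_arc i 2))) (slabel t (pd_arc i 2))) * rest.
  move=> /(set_crossing_constant vi lv) lw.
  rewrite ffunE tv eqxx (big_circles_split _ i); last first.
    move=> x y xy; rewrite (lw _ _ xy); congr frob_coef.
    by apply: slabel_constant; rewrite tv.
  by rewrite w02; congr (_ * _); apply: eq_bigl => a; rewrite (untouched_flip vw wi).
have edge_st b c : edge_coef F i (st b c) t =
    if same_circle v (pd_arc i 0) (pd_arc i 2)
    then comul_coef F b (slabel t (pd_arc i 0)) (slabel t (pd_arc i 2))
    else mul_coef F b c (slabel t (pd_arc i 0)).
  by have [sv su] := st_v b c; rewrite edge_coefE ?sv // st0 st2; case: same_circle.
move: T_t T_st edge_st; rewrite /edge_factor; case: ifP => s02.
  move=> T_t T_st edge_st; rewrite T_t ?oner_eq0 // mul1r big_bool !T_st !edge_st.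
  rewrite -(lv _ _ s02) !comul_coefE !coef_XY.
  by case: (l _) (slabel t _) (slabel t _) => [] [] [] /=; ring.
have [l02|nl] := eqVneq (l (pd_arc i 0)) (l (pd_arc i 2)) => T_t T_st edge_st.
  rewrite T_t ?eta_neq0 // !big_bool !T_st !edge_st !mul_coefE !coef_XY -l02 /eta.
  by case: (l _) (slabel t _) => [] [] /=; ring.
rewrite !big_bool !T_st !edge_st !mul_coefE !coef_XY mul0r.
by move: nl; case: (l _) (l _) (slabel t _) => [] [] [] //= _; ring.
Qed.

Lemma ckh_diff_XY v l : constant_on_circles v l ->
  ckh_diff (tensorXY F v l) =
  \sum_(i | ~~ v i) (edge_sign F i v * edge_factor v i l) *: tensorXY F (set_crossing v i) l.
Proof.
move=> lv; apply/ffunP => t; rewrite ffunE sum_ffunE exchange_big [RHS]big_mkcond /=.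
apply: eq_bigr => i _.
have -> : \sum_s edge_sign F i (svertex s) * edge_coef F i s t * tensorXY F v l s =
    edge_sign F i v * \sum_s edge_coef F i s t * tensorXY F v l s.
  rewrite mulr_sumr; apply: eq_bigr => s _; rewrite mulrA.
  by rewrite [tensorXY _ _ _ _]ffunE; case: eqP => [->|]; rewrite ?mulr0.
case: ifP => vi; first by rewrite edge_tensorXY // [in RHS]ffunE; apply: mulrA.
rewrite big1 ?mulr0 // => s _; rewrite [tensorXY _ _ _ _]ffunE.
case: eqP => [sv|]; last by rewrite mulr0.
have [-> |/edge_coef_vertex[]] := eqVneq (edge_coef F i s t) 0; first by rewrite mul0r.
by rewrite sv vi.
Qed.

(** An edge scales a tensor of X and Y and keeps its label at [p], which alone determines the scalar
    of the marked multiplication. *)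
Lemma ckh_diff_mark p b w : ckh_diff (mark p (XY F b) w) = mark p (XY F b) (ckh_diff w).
Proof.
move: w; apply: (twisted_linear_ext (tau := idfun)) => [|c w w'|c w w'|v l lv].
- exact: hvar_neq0.
- by rewrite mark_lin ckh_diff_lin.
- by rewrite ckh_diff_lin mark_lin.
rewrite mark_XY // (twisted_linearZ (@ckh_diff_lin F D)) ckh_diff_XY //.
rewrite (twisted_linear_sum (mark_lin p (XY F b))) scaler_sumr.
apply: eq_bigr => i vi; rewrite (twisted_linearZ (mark_lin p (XY F b))).
have [->|fn0] := eqVneq (edge_factor v i l) 0; first by rewrite mulr0 !scale0r scaler0.
rewrite mark_XY; last exact: set_crossing_constant.
by rewrite !scalerA mulrC.
Qed.

(** The involution swaps X and Y and sends h to -h. Both operations exchange the merge factors h and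
    -h, while split factors and edge signs are fixed. *)
Lemma ckh_diff_sigma_hat w : ckh_diff (sigma_hat w) = sigma_hat (ckh_diff w).
Proof.
move: w; apply: (twisted_linear_ext (tau := comp_poly (- h))) => [|c w w'|c w w'|v l lv].
- by rewrite (sigma_hvar F) oppr_eq0 hvar_neq0.
- by rewrite sigma_hat_lin ckh_diff_lin.
- by rewrite ckh_diff_lin sigma_hat_lin.
have nlv : constant_on_circles v (fun a => ~~ l a) by move=> a b /lv ->.
rewrite sigma_hat_XY !ckh_diff_XY // (twisted_linear_sum (@sigma_hat_lin F D)).
apply: eq_bigr => i vi; rewrite (twisted_linearZ (@sigma_hat_lin F D)) sigma_hat_XY.
congr (_ *: _); rewrite rmorphM; congr (_ * _).
  by rewrite /edge_sign rmorphXn rmorphN1.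
rewrite /edge_factor; case: same_circle; first by rewrite rmorph1.
have -> : (~~ l (pd_arc i 0) == ~~ l (pd_arc i 2)) = (l (pd_arc i 0) == l (pd_arc i 2)).
  by case: (l _) (l _) => [] [].
case: (l (pd_arc i 0) == _); last by rewrite rmorph0.
by rewrite (sigma_eta F); case: (l _); rewrite /eta ?opprK.
Qed.

End Differential.

(** * The basis z, nu(z) *)

Section Reduced.
Variables (F : fieldType) (D : link_diagram) (p : 'I_(narcs D)).
Local Notation R := {poly F}.
Local Notation CKh := (CKh F D).
Local Notation h := (hvar F).
Local Notation mul b := (mark p (XY F b)).
Implicit Types (w y z : CKh) (b : bool) (c r : R).

Lemma eta_negb b : eta F (~~ b) = - eta F b.
Proof. by case: b; rewrite /eta ?opprK. Qed.

Lemma mark_markE b w : mul b (mul b w) = eta F b *: mul b w.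
Proof.
move: w; apply: (twisted_linear_ext (tau := idfun)) => [|c w w'|c w w'|v l lv].
- exact: hvar_neq0.
- by rewrite !mark_lin.
- by rewrite mark_lin scalerDr !scalerA mulrC.
rewrite !mark_XY // (twisted_linearZ (mark_lin p (XY F b))) mark_XY //.
by case: eqP; rewrite ?scale0r ?scaler0.
Qed.

Lemma mark_sub b w : mul b w - mul (~~ b) w = eta F b *: w.
Proof.
pose Phi w := mul b w - mul (~~ b) w; rewrite -/(Phi w).
move: w; apply: (twisted_linear_ext (tau := idfun)) => [|c w w'|c w w'|v l lv].
- exact: hvar_neq0.
- by rewrite /Phi !mark_lin scalerBr opprD addrACA.
- by rewrite scalerDr !scalerA mulrC.
rewrite /Phi !mark_XY //.
case: (l p) b @Phi => [] [] _ //=;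
  by rewrite scale0r ?subr0 // sub0r /eta ?scaleNr ?opprK.
Qed.

Lemma sigma_hat_mark b w : sigma_hat (mul b w) = mul (~~ b) (sigma_hat w).
Proof.
move: w; apply: (twisted_linear_ext (tau := comp_poly (- h))) => [|c w w'|c w w'|v l lv].
- by rewrite (sigma_hvar F) oppr_eq0 hvar_neq0.
- by rewrite mark_lin sigma_hat_lin.
- by rewrite sigma_hat_lin mark_lin.
have nlv : constant_on_circles v (fun a => ~~ l a) by move=> a a' /lv ->.
rewrite mark_XY // (twisted_linearZ (@sigma_hat_lin F D)) sigma_hat_XY mark_XY //.
congr (_ *: _); rewrite (inj_eq negb_inj); case: eqP => _; last exact: rmorph0.
by rewrite (sigma_eta F) eta_negb.
Qed.

Lemma sigma_hatK : involutive (@sigma_hat F D).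
Proof.
apply: (twisted_linear_ext (tau := idfun)) => [|c w w'|c w w'|v l lv].
- exact: hvar_neq0.
- rewrite !sigma_hat_lin; congr (_ *: _ + _); exact: sigma_hK.
- by [].
rewrite !sigma_hat_XY; apply: eq_pure_tensor => a _; by rewrite negbK.
Qed.

Lemma ckh_diffZ c w : ckh_diff (c *: w) = c *: ckh_diff w.
Proof. exact: (twisted_linearZ (tau := idfun) (@ckh_diff_lin F D)). Qed.

Lemma ckh_diffD w w' : ckh_diff (w + w') = ckh_diff w + ckh_diff w'.
Proof. exact: (twisted_linearD (tau := idfun) (@ckh_diff_lin F D)). Qed.

Lemma markZ b c w : mul b (c *: w) = c *: mul b w.
Proof. exact: (twisted_linearZ (tau := idfun) (mark_lin p _)). Qed.

Lemma markB b w w' : mul b (w - w') = mul b w - mul b w'.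
Proof. exact: (twisted_linearB (tau := idfun) (mark_lin p _)). Qed.

Lemma sigma_hatZ c w : sigma_hat (c *: w) = sigma_h c *: sigma_hat w.
Proof. exact: (twisted_linearZ (@sigma_hat_lin F D)). Qed.

Lemma sigma_hatB w w' : sigma_hat (w - w') = sigma_hat w - sigma_hat w'.
Proof. exact: (twisted_linearB (@sigma_hat_lin F D)). Qed.

Lemma sigma_h_eq0 c : (sigma_h c == 0) = (c == 0).
Proof.
have s0 : sigma_h (0 : R) = 0 by exact: (rmorph0 (comp_poly (- h))).
apply/eqP/eqP => [c0|->] //; have <- : sigma_h (sigma_h c) = c by exact: sigma_hK.
by rewrite c0.
Qed.

(** Multiplication by the marked factor sends 1 to that factor, which produces every generator, and
    sends X to a multiple of it, so the image stays in the span. *)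
Lemma reduced_complexP b w :
  reduced_complex p b w <-> exists y, w = mul b y.
Proof.
change (reduced_complex p b w) with (marked_complex p (XY F b) w); split=> [[c ->]|[y ->]].
  have /(_ _)/sigW re s : exists t : state D, (svertex t == svertex s) &&
      [forall a, slabel t a == if same_circle (svertex s) p a then false else slabel s a].
    have [|t [tv tl]] := @exists_state D (svertex s)
        (fun a => if same_circle (svertex s) p a then false else slabel s a).
      move=> x y xy; rewrite ![same_circle _ p _]same_circle_sym (same_circle_congr _ xy).
      by case: ifP => // _; apply: slabel_constant.
    by exists t; rewrite tv eqxx; apply/forallP => a; rewrite tl.
  exists (\sum_s c s *: basis_chain F (sval (re s))).
  rewrite (twisted_linear_sum (tau := idfun) (mark_lin p _)); apply: eq_bigr => s _.
  rewrite markZ; congr (_ *: _); case: (re s) => t /= /andP[/eqP tv /forallP tl].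
  rewrite (mark_basis _ _ tv); apply: eq_pure_tensor => a _; rewrite (eqP (tl a)).
  by case: ifP => //= _; rewrite mulr1.
pose lam (e : bool) : R := if e then (if b then h else 0) else 1.
have lamP e : XY F b * frob_basis F e = lam e *: XY F b.
  case: e => /=; last by rewrite mulr1 scale1r.
  by rewrite -[Xfrob F]/(XY F true) mul_XY /lam; case: b @lam.
exists (fun s => y s * lam (slabel s p)); apply: eq_bigr => s _.
rewrite -scalerA; congr (_ *: _); rewrite -(pure_tensor_scale _ p).
apply: eq_pure_tensor => a _; case: ifP => // pa.
by rewrite lamP (slabel_constant pa).
Qed.

Lemma chainE : (forall w w' s, (w + w') s = (w s : R) + w' s) *
  (forall w s, (- w) s = - (w s : R)) * (forall c w s, (c *: w) s = c * (w s : R)).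
Proof. by split=> [|c w s]; [split=> [w w' s|w s]|]; rewrite !ffunE. Qed.

Local Notation tors := (torsion_class (@full_complex F D)).

Lemma torsD w w' : tors w -> tors w' -> tors (w + w').
Proof.
move=> [r r0 [y _ ry]] [r' r0' [y' _ ry']].
exists (r * r'); first by rewrite mulf_neq0.
exists (r' *: y + r *: y') => //.
by rewrite ckh_diffD !ckh_diffZ -ry -ry' scalerDr !scalerA mulrC.
Qed.

Lemma torsZ c w : tors w -> tors (c *: w).
Proof.
move=> [r r0 [y _ ry]]; exists r => //; exists (c *: y) => //.
by rewrite ckh_diffZ -ry !scalerA mulrC.
Qed.

Lemma torsB w w' : tors w -> tors w' -> tors (w - w').
Proof. by move=> tw tw'; rewrite -scaleN1r; apply/torsD/torsZ. Qed.

Lemma tors_div c w : c != 0 -> tors (c *: w) -> tors w.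
Proof.
move=> c0 [r r0 [y _ ry]]; exists (r * c); first by rewrite mulf_neq0.
by exists y; rewrite -?ry ?scalerA.
Qed.

Lemma tors_mark b w : tors w -> tors (mul b w).
Proof.
move=> [r r0 [y _ ry]]; exists r => //; exists (mul b y) => //.
by rewrite ckh_diff_mark -ry markZ.
Qed.

Lemma tors_sigma_hat w : tors w -> tors (sigma_hat w).
Proof.
move=> [r r0 [y _ ry]]; exists (sigma_h r); first by rewrite sigma_h_eq0.
by exists (sigma_hat y); rewrite // ckh_diff_sigma_hat -ry sigma_hatZ.
Qed.

(** Multiplying a relation r U y = d x of the full complex by U gives eta r U y = d (U x), because U
    U = eta U; this is a relation in the reduced complex. *)
Lemma tors_reduced b y : torsion_class (reduced_complex p b) (mul b y) <-> tors (mul b y).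
Proof.
split=> [[r r0 [x _ rx]]|[r r0 [x _ rx]]]; first by exists r => //; exists x.
exists (eta F b * r); first by rewrite mulf_neq0 ?eta_neq0.
exists (mul b x); first by apply/reduced_complexP; exists x.
by rewrite ckh_diff_mark -rx markZ mark_markE scalerA mulrC.
Qed.

Lemma sigma_h_sub_dvd c : exists e, c - sigma_h c = h * e.
Proof.
have : h %| c - sigma_h c.
  rewrite /hvar -['X]subr0 -[0]/(0%:P) dvdp_XsubCl; apply/rootP.
  by rewrite !hornerE sigma_h0 subrr.
by case/dvdpP => e ->; exists e; rewrite mulrC.
Qed.

Lemma ckh_diff_nu_hat w : ckh_diff w = 0 -> ckh_diff (nu_hat w) = 0.
Proof.
move=> dw; apply: (chain_scale_inj (hvar_neq0 F)).
rewrite -ckh_diffZ nu_hatE scaler0.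
rewrite (twisted_linearB (tau := idfun) (@ckh_diff_lin F D)) ckh_diff_sigma_hat dw.
by rewrite (twisted_linear0 (@sigma_hat_lin F D)) subrr.
Qed.

Lemma mark_nu_hat b w : h *: mul b (nu_hat w) = mul b w - sigma_hat (mul (~~ b) w).
Proof. by rewrite -markZ nu_hatE markB sigma_hat_mark negbK. Qed.

Lemma basis2P x y :
  basis_mod_torsion (@full_complex F D) [tuple x; y] <->
  [/\ ckh_diff x = 0 /\ ckh_diff y = 0,
      forall w, ckh_diff w = 0 -> exists c0 c1, tors (w - (c0 *: x + c1 *: y)) &
      forall c0 c1, tors (c0 *: x + c1 *: y) -> c0 = 0 /\ c1 = 0].
Proof.
split=> [[cyc span free]|[[dx dy] span free]].
  split.
  - by split; [case: (cyc ord0) | case: (cyc ord_max)].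
  - move=> w dw; have [|c] := span w; first by split.
    by rewrite !big_ord_recl big_ord0 addr0 => tw; exists (c ord0), (c (lift ord0 ord0)).
  move=> c0 c1 t01; pose c (i : 'I_2) := if i == ord0 then c0 else c1.
  have c_0 : forall i, c i = 0 by apply: free; rewrite !big_ord_recl big_ord0 addr0.
  by split; [rewrite -(c_0 ord0) | rewrite -(c_0 ord_max)].
split.
- by case=> [[|[|i]] //= ?]; rewrite (tnth_nth 0); split.
- move=> w [_ /span[c0 [c1 tw]]].
  exists (fun i => if i == ord0 then c0 else c1).
  by rewrite !big_ord_recl big_ord0 addr0.
move=> c; rewrite !big_ord_recl big_ord0 addr0 => /free[c0 c1] i.
case: i => [[|[|i]] //= ?]; [rewrite -[RHS]c0 | rewrite -[RHS]c1];
  by congr c; apply/val_inj.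
Qed.

Section Basis.
Variables (b : bool) (z : CKh).
Hypothesis z_basis : basis_mod_torsion (reduced_complex p b) [tuple z].

Let z_cycle : ckh_diff z = 0.
Proof. by case: z_basis => /(_ ord0)[]. Qed.

Let z_mark : exists y, z = mul b y.
Proof. by apply/reduced_complexP; case: z_basis => /(_ ord0)[]. Qed.

Let z_span w : ckh_diff w = 0 -> exists a, tors (mul b w - a *: z).
Proof.
move=> dw; have [y zE] := z_mark; case: z_basis => _ span _.
have [|c] := span (mul b w).
  split; first by apply/reduced_complexP; exists w.
  by rewrite ckh_diff_mark dw (twisted_linear0 (tau := idfun) (mark_lin p _)).
by rewrite big_ord1 [tnth _ _]zE -markZ -markB tors_reduced markB markZ -zE; exists (c ord0).
Qed.

Let z_free c : tors (c *: z) -> c = 0.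
Proof.
have [y zE] := z_mark; case: z_basis => _ _ free.
rewrite zE -markZ -tors_reduced markZ -zE => tz.
by apply: (free (fun=> c) _ ord0); rewrite big_ord1.
Qed.

Let mark_z : mul b z = eta F b *: z.
Proof. by have [y ->] := z_mark; rewrite mark_markE. Qed.

Let mark_negb_z : mul (~~ b) z = 0.
Proof.
by have := mark_sub b z; rewrite mark_z => /eqP; rewrite subr_eq addrC -subr_eq subrr => /eqP.
Qed.

(* For a cycle w, write U w ~ a z, U sigma(w) ~ c z and U nu(w) ~ a' z modulo
   torsion, where U and V are the multiplications by X and Y at p, in the
   order given by [b]. Then h U nu(w) = U w - U sigma(w) gives a - c = h a', so
   +-h w = U w - V w ~ a z - sigma(c) sigma(z) is divisible by h in the span of
   z and nu(z). *)
Let span_full w : ckh_diff w = 0 ->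
  exists c0 c1, tors (w - (c0 *: z + c1 *: nu_hat z)).
Proof.
move=> dw; have [a ta] := z_span dw.
have [|c tc] := @z_span (sigma_hat w).
  by rewrite ckh_diff_sigma_hat dw (twisted_linear0 (@sigma_hat_lin F D)).
have [a' ta'] := z_span (ckh_diff_nu_hat dw).
have ac : a - c = h * a'.
  apply/eqP; rewrite -subr_eq0; apply/eqP/z_free.
  have := torsB (torsZ h ta') (torsB ta tc).
  rewrite [h *: (_ - _)]scalerBr mark_nu_hat.
  rewrite (sigma_hat_mark (~~ b)) negbK; congr tors.
  by apply/ffunP => s; rewrite !chainE; ring.
have [e ce] := sigma_h_sub_dvd c.
pose k : R := if b then 1 else -1; have k2 : k * k = 1 by rewrite /k; case: (b); ring.
have etaE : eta F b = k * h by rewrite /eta /k; case: (b); ring.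
(* Since sigma(z) = z - h nu(z) and a = h (a' + e) + sigma(c), the combination a z - sigma(c)
   sigma(z) is h times (a' + e) z + sigma(c) nu(z); the sign k comes from eta = k h. *)
exists (k * (a' + e)), (k * sigma_h c); apply: (tors_div (hvar_neq0 F)).
have ts := tors_sigma_hat tc.
rewrite sigma_hatB sigma_hat_mark sigma_hatK sigma_hatZ in ts.
have := torsZ k (torsB ta ts); congr tors.
have -> : mul b w - a *: z - (mul (~~ b) w - sigma_h c *: sigma_hat z) =
    (mul b w - mul (~~ b) w) - a *: z + sigma_h c *: (z - h *: nu_hat z).
  by rewrite nu_hatE; apply/ffunP => s; rewrite !chainE; ring.
rewrite mark_sub etaE; have -> : a = h * a' + (h * e + sigma_h c) by rewrite -ac -ce; ring.
apply/ffunP => s; rewrite !chainE.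
transitivity (k * k * h * (w s : R) - k * (h * (a' + e) * z s + sigma_h c * h * nu_hat z s)).
  by ring.
by rewrite k2; ring.
Qed.

(** V kills z, while h V nu(z) = - sigma(U z) is a nonzero multiple of sigma(z). A further sigma
    turns the relation into one for z alone, which forces c1 = 0. *)
Let full_free c0 c1 : tors (c0 *: z + c1 *: nu_hat z) -> c0 = 0 /\ c1 = 0.
Proof.
move=> t01; have c1_0 : c1 = 0.
  have := torsZ h (tors_mark (~~ b) t01).
  rewrite mark_lin /= mark_negb_z scaler0 add0r markZ scalerA mulrC -scalerA mark_nu_hat.
  rewrite mark_negb_z sub0r negbK mark_z sigma_hatZ -scaleN1r !scalerA.
  move=> /tors_sigma_hat; rewrite sigma_hatZ sigma_hatK => /z_free/eqP.
  rewrite sigma_h_eq0 !mulf_eq0 sigma_h_eq0 (negPf (eta_neq0 F b)) oppr_eq0 oner_eq0 !orbF.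
  by move/eqP.
by split=> //; apply: z_free; move: t01; rewrite c1_0 scale0r addr0.
Qed.

Lemma basis_nu_hat : basis_mod_torsion (@full_complex F D) [tuple z; nu_hat z].
Proof.
apply/basis2P; split; [|exact: span_full|exact: full_free].
by split; [exact: z_cycle | exact/ckh_diff_nu_hat/z_cycle].
Qed.

End Basis.
End Reduced.

(** * Gradings *)

Section Gradings.
Variables (F : fieldType) (D : link_diagram).
Local Notation R := {poly F}.
Local Notation CKh := (CKh F D).
Local Notation h := (hvar F).
Local Notation croots v := (roots (resolution v)).
Local Notation tors := (torsion_class (@full_complex F D)).
Implicit Types (v : vertex D) (w y z : CKh) (c r : R) (s t : state D) (j n m : int).

Definition q_homogeneous j w :=
  forall s k, (w s : R)`_k != 0 -> qdeg k s = j.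

Definition q_part j w : CKh :=
  [ffun s => \poly_(k < size (w s : R)) (if qdeg k s == j then (w s : R)`_k else 0)].

Lemma q_partE j w s k :
  (q_part j w s : R)`_k = if qdeg k s == j then (w s : R)`_k else 0.
Proof.
rewrite ffunE coef_poly; case: ltnP => // szk; rewrite nth_default //.
by case: ifP.
Qed.

Lemma q_partB j w w' : q_part j (w - w') = q_part j w - q_part j w'.
Proof.
apply/ffunP => s; rewrite !chainE; apply/polyP => k.
rewrite q_partE chainE !coefD !chainE !coefN !q_partE.
by case: ifP => // _; rewrite subr0.
Qed.

Lemma coefM_neq0 (f g : R) k : (f * g)`_k != 0 ->
  exists i l, [/\ k = (i + l)%N, f`_i != 0 & g`_l != 0].
Proof.
rewrite coefM => nz.
have [i] : exists i : 'I_k.+1, f`_i * g`_(k - i) != 0.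
  apply/existsP; apply: contraNT nz; rewrite negb_exists => /forallP z.
  by apply/eqP/big1 => i _; apply/eqP; have := z i; rewrite negbK.
rewrite mulf_eq0 negb_or => /andP[fi gi].
by exists i, (k - i)%N; rewrite subnKC // -ltnS.
Qed.

Lemma sum_neq0 (I : finType) (f : I -> R) k :
  (\sum_i f i)`_k != 0 -> exists i, (f i)`_k != 0.
Proof.
rewrite coef_sum => nz; apply/existsP; apply: contraNT nz.
rewrite negb_exists => /forallP z.
by apply/eqP/big1 => i _; apply/eqP; have := z i; rewrite negbK.
Qed.

Lemma qdegD k l s : qdeg (k + l) s = qdeg k s + 2 * l%:Z.
Proof. rewrite /qdeg; lia. Qed.

(** As h has degree 2, only the coefficients of h^i with n + 2i = j contribute. Giving c' by its
    coefficients lets it be zero or a monomial. *)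
Lemma q_part_scale j n c c' w : q_homogeneous n w ->
  (forall i, c'`_i = if n + 2 * i%:Z == j then c`_i else 0) ->
  q_part j (c *: w) = c' *: w.
Proof.
move=> wn c'E; apply/ffunP => s; apply/polyP => k; rewrite q_partE !chainE !coefM.
case: ifP => kj; last apply/esym/big1; [apply: eq_bigr|] => i _; rewrite c'E;
  have [->|/wn wi] := eqVneq ((w s : R)`_(k - i)) 0; rewrite ?mulr0 //;
  have := qdegD (k - i) i s; rewrite subnK ?(leq_ord i) // wi => <-; rewrite kj //.
by rewrite mul0r.
Qed.

(** A matrix whose entries preserve q-degree commutes with the projection; the second premise says
    that each term h^k t in the image of s has the degree of s. *)
Lemma q_part_kernel (K : state D -> state D -> R) (Phi : CKh -> CKh) j w :
  (forall w t, Phi w t = \sum_s K s t * (w s : R)) ->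
  (forall s t k, (K s t)`_k != 0 -> qdeg k t = qdeg 0 s) ->
  q_part j (Phi w) = Phi (q_part j w).
Proof.
move=> PhiE Kh; apply/ffunP => t; apply/polyP => k.
rewrite q_partE !PhiE !coef_sum.
have kE s (i : 'I_k.+1) : (K s t)`_i != 0 -> qdeg (k - i) s = qdeg k t.
  move=> /Kh; have := qdegD i (k - i) t; have := qdegD 0 (k - i) s.
  by rewrite add0n subnKC ?(leq_ord i) // => -> -> ->.
case: ifP => kj; last apply/esym/big1; [apply: eq_bigr|] => s _; rewrite !coefM;
  [apply: eq_bigr | apply: big1] => i _; rewrite q_partE;
  have [->|/kE ->] := eqVneq (K s t)`_i 0; rewrite ?mul0r // kj //.
by rewrite mulr0.
Qed.

Lemma ncirclesE v : ncircles v = (\sum_(a | croots v a) 1)%N.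
Proof. by rewrite sum1_card; apply: eq_card => a; rewrite !inE andbT. Qed.

Lemma nXE s : nX s = (\sum_(a | croots (svertex s) a) slabel s a)%N.
Proof.
rewrite /nX -sum1_card big_mkcond [RHS]big_mkcond; apply: eq_bigr => a _.
by rewrite inE; case: (roots _ _) (slabel s a) => [] [].
Qed.

Lemma weight_set v i : ~~ v i -> weight (set_crossing v i) = (weight v).+1.
Proof.
move=> vi; rewrite /weight (cardD1 i) inE ffunE eqxx add1n; congr S.
apply: eq_card => k; rewrite !inE ffunE; case: eqP => [->|_] //=.
by rewrite (negPf vi).
Qed.

Lemma coefC_neq0 (e : bool) k : ((e%:R : R)`_k != 0) -> e /\ k = 0%N.
Proof. by case: e; rewrite ?coef0 ?eqxx // coef1; case: k => //= k; rewrite eqxx. Qed.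

Lemma coef_hvar_neq0 k : h`_k != 0 -> k = 1%N.
Proof. by rewrite coefX; have [|_] := eqVneq k 1%N; rewrite ?eqxx. Qed.

(** Each edge raises the weight by one. A merge loses a circle and m has degree 0; a split gains a
    circle and Delta has degree 2; in gr_q the changes cancel. *)
Lemma edge_coef_homogeneous i s t k :
  (edge_coef F i s t)`_k != 0 -> qdeg k t = qdeg 0 s.
Proof.
move=> nz; have e0 : edge_coef F i s t != 0.
  by apply: contraNneq nz => ->; rewrite coef0.
have [vi tv sl] := edge_coef_vertex e0; rewrite edge_coefE // in nz.
set v := svertex s in vi tv sl nz *.
have vw := @set_crossing_off D v i; have wi := set_crossing_on vi.
have w02 := same_circle_flip vw wi.
have tl := slabel_constant (s := t); rewrite tv in tl.
rewrite /qdeg !ncirclesE !nXE tv -/v (weight_set vi).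
have split_sum := @big_circles_split D nat 0%N addn.
rewrite (split_sum (fun=> 1%N) (set_crossing v i) i) //.
rewrite (split_sum (fun a => slabel t a : nat) _ i); last by move=> a b /tl ->.
rewrite (split_sum (fun=> 1%N) v i) //.
rewrite (split_sum (fun a => slabel s a : nat) v i); last first.
  by move=> a b /slabel_constant ->.
have restE (f : 'I_(narcs D) -> nat) :
    (\sum_(a | croots (set_crossing v i) a && ~~ touched (set_crossing v i) i a) f a =
     \sum_(a | croots v a && ~~ touched v i a) f a)%N.
  by apply: eq_bigl => a; rewrite (untouched_flip vw wi).
rewrite w02 /= !restE.
have -> : (\sum_(a | croots v a && ~~ touched v i a) slabel t a =
           \sum_(a | croots v a && ~~ touched v i a) slabel s a)%N.
  by apply: eq_bigr => a /andP[_ /sl ->].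
move: (\sum_(_ | _ && _) _)%N (\sum_(_ | _ && _) _)%N (weight v) => n1 n2 wv.
move: nz; case: same_circle => /=.
  rewrite comul_coefE; case: (slabel s _) (slabel t _) (slabel t _) => [] [] [] /=;
    rewrite ?coef0 ?eqxx // ?coefN ?oppr_eq0 => /=;
    first [move/(@coefC_neq0 true)=> [_ ->] | move/coef_hvar_neq0 => ->]; lia.
rewrite mul_coefE; case: (slabel s _) (slabel s _) (slabel t _) => [] [] [] /=;
  rewrite ?coef0 ?eqxx // => /=;
  first [move/(@coefC_neq0 true)=> [_ ->] | move/coef_hvar_neq0 => ->]; lia.
Qed.

Lemma q_part_diff j w : q_part j (ckh_diff w) = ckh_diff (q_part j w).
Proof.
apply: (q_part_kernel
  (K := fun s t => \sum_i edge_sign F i (svertex s) * edge_coef F i s t)) => [{}w t|s t k].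
  by rewrite ffunE; apply: eq_bigr => s _; rewrite mulr_suml.
move/sum_neq0 => [i]; rewrite /edge_sign -signr_odd mulr_sign.
by case: (odd _); rewrite ?coefN ?oppr_eq0 => /edge_coef_homogeneous.
Qed.

End Gradings.

(** * Degrees of sigma and nu, and comparison of graded bases *)

Section GradedBases.
Variables (F : fieldType) (D : link_diagram).
Local Notation R := {poly F}.
Local Notation CKh := (CKh F D).
Local Notation h := (hvar F).
Local Notation croots v := (roots (resolution v)).
Local Notation tors := (torsion_class (@full_complex F D)).
Implicit Types (w x y z : CKh) (c r : R) (s t : state D) (j n m : int).

Lemma sigma_h_coef_neq0 r k : (sigma_h r)`_k != 0 -> r`_k != 0.
Proof.
rewrite /sigma_h comp_polyE => /sum_neq0[i].
rewrite exprNn -signr_odd scalerAr mulr_sign; case: (odd i); rewrite ?coefN ?oppr_eq0;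
  by rewrite coefZ coefXn; case: (k =P i) => [->|]; rewrite ?mulr1 // mulr0 eqxx.
Qed.

Lemma sigma_coef_homogeneous s t k :
  (pure_tensor (svertex s) (fun a => sigma_frob (frob_basis F (slabel s a))) t : R)`_k != 0 ->
  qdeg k t = qdeg 0 s.
Proof.
rewrite ffunE; have [vts nz|_] := eqVneq (svertex t) (svertex s); last by rewrite coef0 eqxx.
rewrite /qdeg !nXE vts.
suff : (k + \sum_(a | croots (svertex s) a) slabel t a =
        \sum_(a | croots (svertex s) a) slabel s a)%N by lia.
(* [P] compares exponents of h with numbers of labels X. It is additive over circles, where sigma(X)
   = X - h either keeps X or trades it for h. *)
pose P (r : R) (n1 n2 : nat) := forall k, r`_k != 0 -> (k + n1 = n2)%N.
move: k nz; apply: (big_rec3 P) => [k|a r n1 n2 ra IH k].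
  by rewrite coef1; case: k => //= k; rewrite eqxx.
case/coefM_neq0 => i [l [-> ai /IH <-]].
suff : (i + slabel t a = slabel s a)%N by lia.
move: ai; rewrite sigma_frob_basis.
case: (slabel s a) (slabel t a) => [] [] /=;
  rewrite ?mul0r ?mul1r ?subr0 ?sub0r ?coefN ?oppr_eq0 ?coef0 ?eqxx //.
- by move/(@coefC_neq0 F true) => [_ ->].
- by move/coef_hvar_neq0 => ->.
by move/(@coefC_neq0 F true) => [_ ->].
Qed.

Lemma sigma_hat_homogeneous j w : q_homogeneous j w -> q_homogeneous j (sigma_hat w).
Proof.
move=> wj t k; rewrite /sigma_hat sum_ffunE => /sum_neq0[s].
rewrite ffunE => /coefM_neq0[i [l [-> /sigma_h_coef_neq0/wj ij /sigma_coef_homogeneous lt]]].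
by have := qdegD l i t; have := qdegD 0 i s; rewrite add0n addnC ij lt => -> ->.
Qed.

Lemma nu_hat_homogeneous j w : q_homogeneous j w -> q_homogeneous (j - 2) (nu_hat w).
Proof.
move=> wj s k nz.
(* Coefficient k of nu(w) is coefficient k + 1 of w - sigma(w), and h has degree 2. *)
have : ((h *: nu_hat w) s : R)`_k.+1 != 0 by rewrite chainE coefXM.
rewrite nu_hatE !chainE coefB => nz'.
have : ((w s : R)`_k.+1 != 0) || ((sigma_hat w s : R)`_k.+1 != 0).
  by apply: contraNT nz'; rewrite negb_or !negbK => /andP[/eqP -> /eqP ->]; rewrite subr0.
by case/orP => [/wj|/(sigma_hat_homogeneous wj)]; have := qdegD k 1 s; rewrite addn1 /=; lia.
Qed.

Lemma basis2C x y :
  basis_mod_torsion (@full_complex F D) [tuple x; y] ->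
  basis_mod_torsion (@full_complex F D) [tuple y; x].
Proof.
move=> /basis2P[[dx dy] span free]; apply/basis2P; split=> // [w /span[c0 [c1]]|c0 c1].
  by rewrite addrC; exists c1, c0; rewrite [_ *: y + _]addrC -[_ - _]addrC.
by rewrite addrC => /free[].
Qed.

(* The lowest term of the torsion relation, in q-degree n + 2k, involves
   neither u nor y. *)
Lemma lowest_coef0 x y u n j a b :
  basis_mod_torsion (@full_complex F D) [tuple x; y] ->
  q_homogeneous n x -> q_homogeneous (n + 2) y -> q_homogeneous j u -> n < j ->
  tors (u - (a *: x + b *: y)) -> a`_0 = 0.
Proof.
move=> /basis2P[_ _ free] xn yn uj lt_nj [r r0 [Y _ rE]].
have ex : exists k, r`_k != 0.
  by exists (size r).-1; rewrite -/(lead_coef r) lead_coef_eq0.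
case: (ex_minnP ex) => k rk kmin.
have rlt i : (i < k)%N -> r`_i = 0.
  by move=> ik; apply/eqP; apply: contraTT ik => /kmin; rewrite -leqNgt.
(* Here k is the lowest exponent of r. In this degree u and y meet only coefficients of r below k,
   which vanish, and x meets the product of r_k and a_0. *)
have := congr1 (q_part (n + 2 * k%:Z)) rE.
have -> : r *: (u - (a *: x + b *: y)) = r *: u - (r * a) *: x - (r * b) *: y.
  by apply/ffunP => s; rewrite !chainE; ring.
rewrite !q_partB q_part_diff.
rewrite (q_part_scale (c' := 0) uj); last first.
  move=> i; rewrite coef0; case: eqP => // e; apply/esym/rlt.
  by move: lt_nj e; lia.
rewrite (q_part_scale (c' := (r`_k * a`_0) *: 'X^k) xn); last first.
  move=> i; rewrite coefZ coefXn; case: (eqVneq i k) => [->|ik].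
    rewrite eqxx mulr1 coefM big_ord_recr /= subnn big1 ?add0r // => l _.
    by rewrite rlt ?mul0r.
  by rewrite mulr0; case: eqP => // e; move/eqP: ik; move: e; lia.
rewrite (q_part_scale (c' := 0) yn); last first.
  move=> i; rewrite coef0; case: eqP => // e; rewrite coefM big1 // => l _.
  by rewrite rlt ?mul0r //; have := ltn_ord l; lia.
rewrite !scale0r sub0r subr0 => tx.
have [|/eqP] := free (- ((r`_k * a`_0) *: 'X^k)) 0.
  rewrite scale0r addr0 scaleNr tx; exists 1; first exact: oner_neq0.
  by rewrite scale1r; exists (q_part (n + 2 * k%:Z) Y).
rewrite oppr_eq0 scale_poly_eq0 mulf_eq0 (negPf rk) -size_poly_eq0 size_polyXn orbF.
by move/eqP.
Qed.

(** If n < m, then x and y lie above degree n, so their coordinates along x' have no constant term.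
    Expressing x' through x and y and back would then give 1 = 0 at h = 0. *)
Lemma graded_basis_le x y x' y' m n :
  q_homogeneous m x -> q_homogeneous (m + 2) y ->
  q_homogeneous n x' -> q_homogeneous (n + 2) y' ->
  basis_mod_torsion (@full_complex F D) [tuple x; y] ->
  basis_mod_torsion (@full_complex F D) [tuple x'; y'] -> m <= n.
Proof.
move=> xm ym xn yn /basis2P[[dx dy] span _] b'; have /basis2P[[dx' _] span' free'] := b'.
rewrite leNgt; apply/negP => lt_nm.
have [c0 [c1 tx']] := span _ dx'.
have [a0 [a1 tx]] := span' _ dx; have [b0 [b1 ty]] := span' _ dy.
have a00 := lowest_coef0 b' xn yn xm lt_nm tx.
have b00 := lowest_coef0 b' xn yn ym (lt_trans lt_nm _) ty.
have [|e _] := free' (1 - c0 * a0 - c1 * b0) (- c0 * a1 - c1 * b1).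
  have := torsD tx' (torsD (torsZ c0 tx) (torsZ c1 ty)); congr tors.
  by apply/ffunP => s; rewrite !chainE; ring.
have := congr1 (fun r : R => r`_0) e.
rewrite !coefB coef1 !coef0M a00 b00 ?ltrDl // !mulr0 !subr0 coef0 => /eqP.
by rewrite oner_eq0.
Qed.

(** As nu lowers the degree by 2, nu(z) and z form a basis of degrees -j' - 1 and -j' + 1; comparing
    it with (x, y) in both directions gives equality. *)
Lemma has_s_reduced (p : 'I_(narcs D)) (b : bool) j j' :
  has_s F D j -> has_reduced_s F p b j' -> j = j'.
Proof.
move=> [x [y [xh yh xy]]] [z zh /basis_nu_hat zb].
have qh i n w : homogeneous i n w -> q_homogeneous n w by move=> wh t k /wh[].
have {}xh := qh _ _ _ xh; have {}yh := qh _ _ _ yh; have {}zh := qh _ _ _ zh.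
have nh := nu_hat_homogeneous zh.
have e : - j' + 1 - 2 = - j' - 1 :> int by lia.
have e' : - j' + 1 = - j' - 1 + 2 :> int by lia.
have e'' : - j + 1 = - j - 1 + 2 :> int by lia.
rewrite e in nh; rewrite e' in zh; rewrite e'' in yh.
have := graded_basis_le nh zh xh yh (basis2C zb) xy.
by have := graded_basis_le xh yh nh zh xy (basis2C zb); lia.
Qed.

End GradedBases.

Theorem proposition3p3 (F : fieldType) (D : link_diagram) (D_knot : is_knot D)
    (p : 'I_(narcs D)) (b : bool) :
  (forall z : CKh F D,
     basis_mod_torsion (reduced_complex p b) [tuple z] ->
     basis_mod_torsion (@full_complex F D) [tuple z; nu_hat z]) /\
  (forall s s' : int,
     has_s F D s -> has_reduced_s F p b s' -> s = s').
Proof. by split=> [z|s s']; [exact: basis_nu_hat | exact: has_s_reduced]. Qed.
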